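(* Let $0<q<\lambda\le1$ and $m>0$. Then pseudodifferential operators in the class $OpS^m_{1,0}(\mathbb{R}^n)$ are not in general bounded on $h\mathcal{M}_q^\lambda(\mathbb{R}^n)$: the operator $J_m(D)\in OpS^m_{1,0}(\mathbb{R}^n)$ with symbol $\langle\xi\rangle^m=(1+|\xi|^2)^{m/2}$ is not bounded from $h\mathcal{M}_q^\lambda(\mathbb{R}^n)$ to itself.
   Context: For $0<q\le\lambda<\infty$ and measurable $g$ on $\mathbb{R}^n$, set $\|g\|_{\mathcal{M}_q^\lambda}:=\sup_Q |Q|^{1/\lambda-1/q}\big(\int_Q|g(y)|^q\,dy\big)^{1/q}$, the supremum being over all cubes $Q\subset\mathbb{R}^n$. Fix $\varphi\in\mathcal{S}(\mathbb{R}^n)$ with $\int\varphi\neq0$ and put $\varphi_t(x)=t^{-n}\varphi(x/t)$. For $f\in\mathcal{S}'(\mathbb{R}^n)$ let $m_\varphi f(x)=\sup_{0<t\le1}|\varphi_t*f(x)|$. The nonhomogeneous (localizable) Hardy-Morrey space $h\mathcal{M}_q^\lambda(\mathbb{R}^n)$ is the set of $f\in\mathcal{S}'(\mathbb{R}^n)$ with $\|f\|_{h\mathcal{M}_q^\lambda}:=\|m_\varphi f\|_{\mathcal{M}_q^\lambda}<\infty$ (independent of the choice of $\varphi$ up to equivalence of quasi-norms). For $m\in\mathbb{R}$, $S^m_{1,0}(\mathbb{R}^n)$ is the set of smooth $a(x,\xi)$ on $\mathbb{R}^n\times\mathbb{R}^n$ with $|\partial_x^\alpha\partial_\xi^\beta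 a(x,\xi)|\le C_{\alpha,\beta}\langle\xi\rangle^{m-|\beta|}$ for all multi-indices $\alpha,\beta$; $OpS^m_{1,0}(\mathbb{R}^n)$ is the set of operators $a(x,D)u(x)=\int e^{2\pi i x\cdot\xi}a(x,\xi)\widehat u(\xi)\,d\xi$, $u\in\mathcal{S}'(\mathbb{R}^n)$ (with $\widehat u(\xi)=\int e^{-2\pi i x\cdot\xi}u(x)\,dx$ extended to tempered distributions). *)

(* Defs.v *)
From HB Require Import structures.
From mathcomp Require Import all_boot all_order all_algebra.
From mathcomp Require Import all_classical all_reals all_analysis.
From mathcomp Require Import complex.

Set Implicit Arguments.
Unset Strict Implicit.
Unset Printing Implicit Defensive.
Import Order.TTheory GRing.Theory Num.Theory.
Import numFieldNormedType.Exports.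
Local Open Scope classical_set_scope.
Local Open Scope ring_scope.
Local Open Scope complex_scope.

(* R^n is 'rV[R]_n, with the sigma-algebra generated by the coordinates.      *)
Section rV_measurable.
Variables (R : realType) (n : nat).

Let coor : 'I_n -> 'rV[R]_n -> R := fun i x => x ord0 i.

Let rV_set0 : g_sigma_preimage coor set0.
Proof. exact: sigma_algebra0. Qed.

Let rV_setC A : g_sigma_preimage coor A -> g_sigma_preimage coor (~` A).
Proof. exact: sigma_algebraC. Qed.

Let rV_bigcup (F : (set 'rV[R]_n)^nat) :
  (forall i, g_sigma_preimage coor (F i)) ->
  g_sigma_preimage coor (\bigcup_i (F i)).
Proof. exact: sigma_algebra_bigcup. Qed.

HB.instance Definition _ := @isMeasurable.Build default_measure_display
  'rV[R]_n (g_sigma_preimage coor) rV_set0 rV_setC rV_bigcup.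

Lemma measurable_coor (i : 'I_n) :
  measurable_fun [set: 'rV[R]_n] (fun x : 'rV[R]_n => x ord0 i).
Proof.
move=> _ Y mY; rewrite setTI; apply: sub_sigma_algebra => /=.
rewrite -bigcup_seq/=; exists i => /=; first by rewrite mem_index_enum.
by exists Y => //; rewrite setTI.
Qed.

Lemma measurable_fun_rVP d (T : measurableType d) (f : T -> 'rV[R]_n) :
  (forall i, measurable_fun [set: T] (fun t => f t ord0 i)) ->
  measurable_fun [set: T] f.
Proof.
move=> mf _ Y mY; rewrite setTI.
have H : g_sigma_preimage (fun i => coor i \o f) `<=` measurable.
  apply: smallest_sub; first exact: sigma_algebra_measurable.
  rewrite -bigcup_seq/=; apply: bigcup_sub => i _ A [B mB <-].
  exact: mf.
apply: H; rewrite g_sigma_preimage_comp.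
by exists Y => //; rewrite setTI.
Qed.

End rV_measurable.

Section lebesgue_rV.
Variable R : realType.

Definition consrV n (p : measurableTypeR R * 'rV[R]_n) : 'rV[R]_n.+1 :=
  \row_i (if unlift ord0 i is Some j then p.2 ord0 j else p.1).

Definition unconsrV n (x : 'rV[R]_n.+1) : measurableTypeR R * 'rV[R]_n :=
  (x ord0 ord0, \row_j x ord0 (lift ord0 j)).

Lemma consrVK n : cancel (@consrV n) (@unconsrV n).
Proof.
move=> [a x]; rewrite /unconsrV mxE unlift_none; congr pair.
by apply/rowP => j; rewrite !mxE liftK.
Qed.

Lemma unconsrVK n : cancel (@unconsrV n) (@consrV n).
Proof.
move=> x; apply/rowP => i; rewrite mxE.
by case: unliftP => [j ->|->] //=; rewrite mxE.
Qed.

Lemma measurable_consrV n : measurable_fun setT (@consrV n).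
Proof.
apply: measurable_fun_rVP => i; rewrite /consrV.
under eq_fun do rewrite mxE.
case: (unlift ord0 i) => [j|]; last exact: measurable_fst.
exact: (measurableT_comp (@measurable_coor R n j) measurable_snd).
Qed.

HB.instance Definition _ n :=
  isMeasurableFun.Build _ _ _ _ (@consrV n) (@measurable_consrV n).

Lemma measurable_unconsrV n : measurable_fun setT (@unconsrV n).
Proof.
apply: measurable_fun_pair; first exact: measurable_coor.
apply: measurable_fun_rVP => i.
under eq_fun do rewrite mxE.
exact: measurable_coor.
Qed.

Section cons_measure.
Variables (n : nat) (mu : {sigma_finite_measure set 'rV[R]_n -> \bar R}).

Definition cons_measure : set 'rV[R]_n.+1 -> \bar R :=
  pushforward (@lebesgue_measure R \x mu)%E (@consrV n).

Let cons_measure0 : cons_measure set0 = 0%E.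
Proof. exact: measure0. Qed.

Let cons_measure_ge0 A : (0 <= cons_measure A)%E.
Proof. exact: measure_ge0. Qed.

Let cons_measure_sigma_additive : semi_sigma_additive cons_measure.
Proof. exact: measure_semi_sigma_additive. Qed.

HB.instance Definition _ := isMeasure.Build _ _ _ cons_measure
  cons_measure0 cons_measure_ge0 cons_measure_sigma_additive.

Let cons_measure_sigma_finite : sigma_finite setT cons_measure.
Proof.
have /sigma_finiteP[F [TF ndF Foo]] := sigma_finiteT (@lebesgue_measure R).
have /sigma_finiteP[G [TG ndG Goo]] := sigma_finiteT mu.
exists (fun k => @unconsrV n @^-1` (F k `*` G k)).
  rewrite -preimage_bigcup -(preimage_setT (@unconsrV n)); congr (_ @^-1` _).
  rewrite -setXTT TF TG predeqE => -[x y]; split.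
    move=> [/= [k _ Fkx] [l _ Gly]]; exists (maxn k l) => //; split.
    - by move: x Fkx; exact/subsetPset/ndF/leq_maxl.
    - by move: y Gly; exact/subsetPset/ndG/leq_maxr.
  by move=> [k _ []/= ? ?]; split; exists k.
move=> k; have [mF Fk] := Foo k; have [mG Gk] := Goo k; split.
  rewrite -[X in measurable X]setTI; apply: measurable_unconsrV => //.
  exact: measurableX.
rewrite /cons_measure /pushforward -comp_preimage.
rewrite (_ : @unconsrV n \o @consrV n = id); last exact/funext/consrVK.
by rewrite preimage_id product_measure1E// lte_mul_pinfty// ge0_fin_numE.
Qed.

HB.instance Definition _ := Measure_isSigmaFinite.Build _ _ _ cons_measure
  cons_measure_sigma_finite.

End cons_measure.

Fixpoint lebesgue_rV n : {sigma_finite_measure set 'rV[R]_n -> \bar R} :=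
  match n with
  | 0 => @dirac _ 'rV[R]_0 0 R
  | n'.+1 => cons_measure (lebesgue_rV n')
  end.

End lebesgue_rV.

Lemma lebesgue_rV_box (R : realType) n (A : 'I_n -> set (measurableTypeR R)) :
  (forall i, measurable (A i)) ->
  lebesgue_rV R n [set x | forall i, A i (x ord0 i)] =
  (\prod_(i < n) lebesgue_measure (A i))%E.
Proof.
elim: n A => [|n IH] A mA.
  rewrite big_ord0 /= diracE mem_set//=.
  by move=> [].
rewrite big_ord_recl -IH; last by move=> i; exact: mA.
rewrite /= /cons_measure /pushforward.
pose B := [set x : 'rV[R]_n | forall i, A (lift ord0 i) (x ord0 i)].
have mB : measurable B.
  rewrite (_ : B = \bigcap_(i in [set: 'I_n])
      ((fun x : 'rV[R]_n => x ord0 i) @^-1` A (lift ord0 i))).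
    apply: fin_bigcap_measurable; first exact: finite_finset.
    move=> i _; rewrite -[X in measurable X]setTI.
    by apply: measurable_coor => //; exact: mA.
  by apply/seteqP; split => [x Bx i _|x Bx i]; [exact: Bx|exact: Bx].
rewrite -[X in (_ * X)%E](_ : (lebesgue_rV R n) B = _)//.
rewrite -(product_measure1E lebesgue_measure (lebesgue_rV R n) (mA ord0) mB).
congr ((lebesgue_measure \x lebesgue_rV R n)%E _).
apply/seteqP; split => [[a x] /= H|[a x] /= [Aa Bx] i].
  split => [|i]; first by have := H ord0; rewrite mxE unlift_none.
  by have := H (lift ord0 i); rewrite mxE liftK.
by rewrite mxE; case: unliftP => [j ->|->]//=; exact: Bx.
Qed.

Local Notation normc := Normc.normc.

Section complex_calculus.
Variables (R : realType) (V : normedModType R).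
Implicit Types (f : V -> R[i]).

Definition cderive (v : V) f : V -> R[i] := fun x =>
  'D_v (fun y => complex.Re (f y)) x +i* 'D_v (fun y => complex.Im (f y)) x.

(* iderive [:: v1; ...; vk] f = D_v1 (... (D_vk f))                           *)
Definition iderive (s : seq V) f : V -> R[i] := foldr cderive f s.

Definition cdifferentiable f (x : V) : Prop :=
  differentiable (fun y => complex.Re (f y)) x /\
  differentiable (fun y => complex.Im (f y)) x.

Definition csmooth f : Prop :=
  forall (s : seq V) (x : V), cdifferentiable (iderive s f) x.

End complex_calculus.

Section multi_indices.
Variables (R : realType) (n : nat).

Definition multi_index := {ffun 'I_n -> nat}.

Definition mabs (alpha : multi_index) : nat := \sum_(i < n) alpha i.

Definition mmonomial (alpha : multi_index) (x : 'rV[R]_n) : R :=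
  \prod_(i < n) x ord0 i ^+ alpha i.

(* the list of directions of d^alpha: e i repeated alpha i times, for all i   *)
Definition mdirs (V : Type) (e : 'I_n -> V) (alpha : multi_index) : seq V :=
  flatten [seq nseq (alpha i) (e i) | i <- enum 'I_n].

Definition basis_rV (i : 'I_n) : 'rV[R]_n := delta_mx ord0 i.

Definition mderive (alpha : multi_index) (f : 'rV[R]_n -> R[i]) :=
  iderive (mdirs basis_rV alpha) f.

(* d_x^alpha d_xi^beta of a function of (x, xi)                               *)
Definition mderive2 (alpha beta : multi_index)
    (a : 'rV[R]_n * 'rV[R]_n -> R[i]) :=
  iderive (mdirs (fun i => (basis_rV i, 0)) alpha ++
           mdirs (fun i => (0, basis_rV i)) beta) a.

End multi_indices.

Section hardy_morrey.
Variables (R : realType) (n : nat).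
Implicit Types (u v phi : 'rV[R]_n -> R[i]) (x y xi c : 'rV[R]_n).
Implicit Types (q lam m t l : R).

Local Notation mu := (lebesgue_rV R n).

Definition cintegral u : R[i] :=
  (\int[mu]_x complex.Re (u x)) +i* (\int[mu]_x complex.Im (u x)).

Definition dotp x y : R := \sum_(i < n) x ord0 i * y ord0 i.

Definition expi (theta : R) : R[i] := cos theta +i* sin theta.

Definition fourier u : 'rV[R]_n -> R[i] := fun xi =>
  cintegral (fun x => expi (- (2 * pi * dotp x xi)) * u x).

Definition schwartz u : Prop :=
  csmooth u /\
  forall alpha beta : multi_index n, exists C : R, forall x,
    normc ((mmonomial alpha x)%:C * mderive beta u x) <= C.

(* A distribution is a functional on all functions, of which only the values  *)
(* at Schwartz functions matter.                                              *)
Definition functional := ('rV[R]_n -> R[i]) -> R[i].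
Implicit Types f : functional.

(* S' : continuity at 0 for the topology of S given by the seminorms          *)
(* sup_x |x^alpha d^beta u(x)|                                                *)
Definition tempered f : Prop :=
  (forall (z : R[i]) u v, schwartz u -> schwartz v ->
     f (fun x => z * u x + v x) = z * f u + f v) /\
  (forall e : R, 0 < e -> exists N : nat, exists2 d : R, 0 < d &
     forall u, schwartz u ->
       (forall alpha beta : multi_index n,
          (mabs alpha <= N)%N -> (mabs beta <= N)%N ->
          forall x, normc ((mmonomial alpha x)%:C * mderive beta u x) <= d) ->
       normc (f u) <= e).

Definition cube c l : set 'rV[R]_n :=
  [set y | forall i, c ord0 i <= y ord0 i <= c ord0 i + l].

Definition morrey_norm q lam (g : 'rV[R]_n -> \bar R) : \bar R :=
  ereal_sup [set (mu Q `^ (lam^-1 - q^-1) *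
                  (\int[mu]_(y in Q) (`|g y| `^ q)) `^ q^-1)%E
            | Q in [set Q | exists c, exists2 l, 0 < l & Q = cube c l]].

Definition dilate phi t : 'rV[R]_n -> R[i] := fun x =>
  (t ^- n)%:C * phi (t^-1 *: x).

(* phi * f (x) = <f, phi(x - .)>                                              *)
Definition convolution phi f : 'rV[R]_n -> R[i] := fun x =>
  f (fun y => phi (x - y)).

Definition maximal phi f : 'rV[R]_n -> \bar R := fun x =>
  ereal_sup [set (normc (convolution (dilate phi t) f x))%:E
            | t in [set t | 0 < t <= 1]].

Definition hM_norm phi q lam f : \bar R := morrey_norm q lam (maximal phi f).

Definition hM phi q lam : set functional :=
  [set f | tempered f /\ (hM_norm phi q lam f < +oo)%E].

Definition japanese xi : R := Num.sqrt (1 + dotp xi xi).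

Definition symbol_class m : set ('rV[R]_n * 'rV[R]_n -> R[i]) :=
  [set a | csmooth a /\
    forall alpha beta : multi_index n, exists C : R, forall x xi,
      normc (mderive2 alpha beta a (x, xi)) <=
      C * japanese xi `^ (m - (mabs beta)%:R)].

(* a(x,D) f for f in S', by duality: integrating                              *)
(*   a(x,D)u(x) = \int e^(2 pi i x.xi) a(x,xi) u^(xi) dxi                     *)
(* against v(x) dx gives <a(x,D)u, v> = <u^, w> = <u, w^> where               *)
(*   w(xi) = \int e^(2 pi i x.xi) a(x,xi) v(x) dx.                            *)
Definition pseudodiff (a : 'rV[R]_n * 'rV[R]_n -> R[i]) (f : functional) :
    functional := fun v =>
  f (fourier (fun xi =>
    cintegral (fun x => expi (2 * pi * dotp x xi) * a (x, xi) * v x))).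

Definition OpS m : set (functional -> functional) :=
  [set pseudodiff a | a in symbol_class m].

Definition bessel_symbol m (p : 'rV[R]_n * 'rV[R]_n) : R[i] :=
  ((1 + dotp p.2 p.2) `^ (m / 2))%:C.

Definition Jop m : functional -> functional := pseudodiff (bessel_symbol m).

(* The norm takes values in \bar R, so the inequality forces hM_norm (T f) to *)
(* be finite; operators in OpS^m map S' to itself, so membership of T f in hM *)
(* amounts to this finiteness.                                                *)
Definition bounded_on_hM phi q lam (T : functional -> functional) : Prop :=
  exists C : R, forall f, hM phi q lam f ->
    (hM_norm phi q lam (T f) <= C%:E * hM_norm phi q lam f)%E.

End hardy_morrey.

Arguments OpS {R} n m.
Arguments Jop {R} n m.

(* Main.v *)
Require Import Defs.
From HB Require Import structures.
From mathcomp Require Import all_boot all_order all_algebra.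
From mathcomp Require Import all_classical all_reals all_analysis.
From mathcomp Require Import complex.
From mathcomp Require Import measurable_realfun ring lra.
Import Order.TTheory GRing.Theory Num.Theory.
Import numFieldNormedType.Exports.
Local Open Scope classical_set_scope.
Local Open Scope ring_scope.
Local Open Scope complex_scope.

(** The operator J_m multiplies the part of a distribution that has frequency
    near w by about |w|^m, while a Hardy-Morrey norm does not see the frequency
    of a modulated bump. The counterexample is therefore the family
      f_w (y) = e^(2 pi i y.w) phi (y),   w = N e_1, N -> oo,
    built on the function phi that defines the norm.

    Upper bound. |phi_t * f_w| (x) is bounded by the convolution of |phi_t| and
    |phi|, hence for t <= 1 by C_k (1 + |x|)^(-k) with C_k independent of w
    (convolution_modulated_le). Such a function has a finite Morrey norm once
    k q >= 2 n (morrey_norm_le), so the norms of the f_w are bounded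
    (modulated_hM_le).

    Lower bound. With F the Fourier transform of phi, Fubini gives
      (phi_t * J_m f_w) (x)
        = int <w + xi>^m e^(2 pi i x.(w + xi)) F (t (w + xi)) F (xi) dxi
    (convolution_bessel). For t = tau / |w| with tau small and |w| large, this
    is e^(2 pi i x.w) <w>^m times a small perturbation of F (0) G (x), where
    G (x) = int e^(2 pi i x.xi) F (xi) dxi. Since int conj(phi) G = int |F|^2 is
    positive, G (x0) is nonzero for some x0 (inverse_fourier_neq0). So the
    maximal function of J_m f_w is at least c |w|^m on a fixed cube near x0
    (convolution_bessel_ge), and J_m is unbounded (Jop_unbounded).

    The integrals above converge because F decreases rapidly (fourier_rapid),
    which is read off from iterated translation differences of phi
    (fourier_chain_decay). That the symbol <xi>^m belongs to S^m is proved by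
    closing it under derivatives in a class of explicit functions graded by
    their order (symbol_like). *)

Set Implicit Arguments.
Unset Strict Implicit.
Unset Printing Implicit Defensive.

Local Notation normc := Normc.normc.

(** * Affine changes of variables *)

Section affine1.
Variable R : realType.
Implicit Types (a s : R).

Definition affine1 a s (x : measurableTypeR R) : measurableTypeR R := a + s * x.

Lemma measurable_affine1 a s : measurable_fun setT (affine1 a s).
Proof. by apply: measurable_funD => //; apply: measurable_funM. Qed.

(** Both sides are measures of A, so half-open intervals suffice; a negative s
    exchanges the open and the closed end point, which does not affect the
    length. *)
Lemma lebesgue_measure_affine a s (A : set (measurableTypeR R)) : s != 0 ->
  measurable A ->
  lebesgue_measure (affine1 a s @^-1` A) =
  ((`|s|^-1)%:E * lebesgue_measure A)%E.
Proof.
move=> s0 mA.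
have ns0 : 0 < `|s| by rewrite normr_gt0.
pose f := affine1 a s.
pose k : {nonneg R} := NngNum (normr_ge0 s).
pose nu := mscale k (pushforward (@lebesgue_measure R) (affine1 a s)).
have -> : lebesgue_measure A = nu (@measurable_affine1 a s) A.
  apply: lebesgue_measure_unique => // X [[x y] /= _ <-].
  rewrite /nu /mscale/= /pushforward.
  have [sp|sn] := ltP 0 s.
    have -> : f @^-1` `]x, y] = `](x - a) / s, (y - a) / s]%classic.
      apply/seteqP; split => z /=; rewrite !in_itv/= /f /affine1 ltr_pdivrMr// ler_pdivlMr//
        ltrBlDl lerBrDl mulrC//.
    rewrite !lebesgue_measure_itv/= !lte_fin ltr_pM2r ?invr_gt0// ltrD2r.
    case: ifPn => xy; last by rewrite mule0.
    rewrite -!EFinB -EFinM gtr0_norm//; congr EFin.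
    by field; exact/eqP/eqP.
  have {}sn : s < 0 by rewrite lt_neqAle s0.
  have -> : f @^-1` `]x, y] = `[(y - a) / s, (x - a) / s[%classic.
    apply/seteqP; split => z /=; rewrite !in_itv/= /f /affine1 ltr_ndivlMr// ler_ndivrMr//
        ltrBlDl lerBrDl mulrC andbC//.
  rewrite !lebesgue_measure_itv/= !lte_fin ltr_nM2r ?invr_lt0// ltrD2r.
  case: ifPn => xy; last by rewrite mule0.
  rewrite -!EFinB -EFinM ltr0_norm//; congr EFin.
  by field; exact/eqP/eqP.
by rewrite /nu /mscale/= muleA -EFinM mulVf ?mul1e// gt_eqF.
Qed.
End affine1.

Section boxes.
Variables (R : realType) (n : nat).
Local Notation mu := (lebesgue_rV R n).

Lemma coord_le_norm (x : 'rV[R]_n) i : `|x ord0 i| <= `|x|.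
Proof.
rewrite [leRHS]/Num.norm /= mx_normrE; apply/bigmax_geP; right => /=.
by exists (ord0, i).
Qed.

Lemma norm_rV_le (x : 'rV[R]_n) (r : R) : 0 <= r ->
  (forall i, `|x ord0 i| <= r) -> `|x| <= r.
Proof.
move=> r0 H; rewrite [leLHS]/Num.norm /= mx_normrE.
apply/bigmax_leP; split => //= -[i j] _ /=.
by rewrite (ord1 i).
Qed.

Definition box (A : 'I_n -> set (measurableTypeR R)) : set 'rV[R]_n :=
  [set x | forall i, A i (x ord0 i)].

Lemma measurable_box A : (forall i, measurable (A i)) -> measurable (box A).
Proof.
move=> mA; rewrite (_ : box A = \bigcap_(i in [set: 'I_n])
    ((fun x : 'rV[R]_n => x ord0 i) @^-1` A i)).
  apply: fin_bigcap_measurable; first exact: finite_finset.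
  move=> i _; rewrite -[X in measurable X]setTI.
  by apply: measurable_coor => //; exact: mA.
by apply/seteqP; split => [x Bx i _|x Bx i]; exact: Bx.
Qed.

Lemma lebesgue_box A : (forall i, measurable (A i)) ->
  mu (box A) = (\prod_(i < n) lebesgue_measure (A i))%E.
Proof. exact: lebesgue_rV_box. Qed.

Definition boxes : set (set 'rV[R]_n) :=
  [set X | exists2 A, (forall i, measurable (A i)) & X = box A].

Lemma measurable_boxesE : @measurable _ 'rV[R]_n = <<s boxes >>.
Proof.
apply/seteqP; split.
  apply: smallest_sub; first exact: smallest_sigma_algebra.
  rewrite -bigcup_seq/=; apply: bigcup_sub => i _ X [B mB <-].
  apply: sub_sigma_algebra; exists (fun j => if j == i then B else setT).
    by move=> j; case: ifPn.
  rewrite setTI; apply/seteqP; split => x /=.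
    by move=> Bx j; case: eqP => [->|].
  by move/(_ i); rewrite eqxx.
apply: smallest_sub; first exact: sigma_algebra_measurable.
by move=> X [A mA ->]; exact: measurable_box.
Qed.

Lemma boxes_setI : setI_closed boxes.
Proof.
move=> X Y [A mA ->] [B mB ->]; exists (fun i => A i `&` B i).
  by move=> i; exact: measurableI.
apply/seteqP; split => x /=; first by move=> [Ax Bx] i; split.
by move=> ABx; split => i; have [] := ABx i.
Qed.

Definition affine (a : 'rV[R]_n) (s : R) (x : 'rV[R]_n) : 'rV[R]_n :=
  a + s *: x.

Lemma measurable_affine (a : 'rV[R]_n) (s : R) : measurable_fun setT (affine a s).
Proof.
apply: measurable_fun_rVP => i.
under eq_fun do rewrite !mxE.
by apply: measurable_funD => //; apply: measurable_funM => //; exact: measurable_coor.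
Qed.

(** Measures that are finite on cubes are determined by boxes, on which the
    one-dimensional case applies to each coordinate. *)
Lemma lebesgue_rV_affine (a : 'rV[R]_n) (s : R) (A : set 'rV[R]_n) : s != 0 ->
  measurable A ->
  mu (affine a s @^-1` A) = ((`|s|^- n)%:E * mu A)%E.
Proof.
move=> s0 mA.
pose f := affine a s.
have k0 : 0 <= `|s|^- n by rewrite invr_ge0 exprn_ge0.
pose k : {nonneg R} := NngNum k0.
pose cub (k : nat) := box (fun=> `[- k%:R, k%:R]%classic).
rewrite -[RHS]/(mscale k mu A) -[LHS]/(pushforward mu (affine a s) A).
apply: (measure_unique boxes cub) => //.
- exact: measurable_boxesE.
- exact: boxes_setI.
- by move=> j; exists (fun=> `[- j%:R, j%:R]%classic).
- apply/seteqP; split => // x _.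
  exists (Num.truncn (`|x| )).+1 => // i /=; rewrite in_itv/= -ler_norml.
  apply: (@le_trans _ _ `|x|); last exact/ltW/truncnS_gt.
  exact: coord_le_norm.
- exact: measurable_affine.
- move=> mf X [B mB ->]; rewrite -[LHS]/(pushforward mu f (box B)).
  have -> : (pushforward mu f) (box B) =
      mu (box (fun i => affine1 (a ord0 i) s @^-1` B i)).
    rewrite /pushforward; congr (mu _); apply/seteqP; split => x /= Bx i.
      by have := Bx i; rewrite /f /affine !mxE.
    by have := Bx i; rewrite /= /f /affine !mxE.
  have mT i : measurable (affine1 (a ord0 i) s @^-1` B i).
    rewrite -[X in measurable X]setTI.
    by apply: measurable_affine1.
  rewrite lebesgue_box// -[RHS]/(k%:num%:E * mu (box B))%E lebesgue_box//=.
  under eq_bigr do rewrite lebesgue_measure_affine//.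
  rewrite big_split/=; congr (_ * _)%E.
  by rewrite prodEFin prodr_const card_ord -exprVn.
- move=> mf j; rewrite -[X in (X < _)%E]/(pushforward mu (affine a s) (cub j)) /pushforward.
  have -> : f @^-1` cub j =
      box (fun i => affine1 (a ord0 i) s @^-1` `[- j%:R, j%:R]).
    apply/seteqP; split => x /= Bx i.
      by have := Bx i; rewrite /f /affine !mxE.
    by have := Bx i; rewrite /= /f /affine !mxE.
  rewrite lebesgue_box; last first.
    by move=> i; rewrite -[X in measurable X]setTI; apply: measurable_affine1.
  under eq_bigr do rewrite lebesgue_measure_affine// lebesgue_measure_itv/=.
  rewrite ltey_eq; apply/orP; left; elim/big_ind : _ => //; first exact: fin_numM.
  by move=> i _; case: ifP => _; rewrite ?mule0 // -EFinB -EFinM.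
Qed.
End boxes.

(** * Measurability of continuous functions *)

Section continuous_measurable.
Variables (R : realType) (n : nat).

(** The sigma-algebra of R^n is generated by the coordinates, so an open set
    is exhibited as a countable union of boxes with rational centres. *)
Lemma open_measurable_rV (U : set 'rV[R]_n) : open U -> measurable U.
Proof.
move=> oU.
pose B (p : 'rV[rat]_n * nat) : set 'rV[R]_n :=
  box (fun i => [set y | `|y - ratr (p.1 ord0 i)| < p.2.+1%:R^-1]).
pose F p := if `[< B p `<=` U >] then B p else set0.
have -> : U = \bigcup_p F p.
  apply/seteqP; split => [x Ux|x [p _]]; last first.
    by rewrite /F; case: ifPn => // /asboolP; apply.
  have /nbhs_ballP[e /= e0 eU] : nbhs x U by exact: open_nbhs_nbhs.
  pose k := Num.truncn (2 / e).
  have k0 : 0 < k.+1%:R^-1 :> R by rewrite invr_gt0.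
  have ke : k.+1%:R^-1 < e / 2.
    rewrite invf_plt ?posrE ?divr_gt0//; rewrite invf_div; exact: truncnS_gt.
  have /choice[c cP] : forall i, exists c : rat, `|x ord0 i - ratr c| < k.+1%:R^-1.
    move=> i.
    have : x ord0 i - k.+1%:R^-1 < x ord0 i + k.+1%:R^-1 by rewrite ltrD2l gtrN.
    move=> /rat_in_itvoo[c]; rewrite in_itv/= => /andP[c1 c2]; exists c.
    rewrite ltr_norml; move: c1 c2; set r := k.+1%:R^-1; set d := ratr c => c1 c2.
    by apply/andP; split; lra.
  exists (\row_i c i, k) => //; rewrite /F.
  case: ifPn => [_ i /=|/asboolP]; first by rewrite mxE.
  case=> y By; apply: eU; rewrite -ball_normE/=.
  apply: (@le_lt_trans _ _ (k.+1%:R^-1 + k.+1%:R^-1)).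
    apply: norm_rV_le => [|i]; first by rewrite addr_ge0// ltW.
    rewrite !mxE (_ : _ - _ = (x ord0 i - ratr (c i)) - (y ord0 i - ratr (c i))); last by ring.
    rewrite (le_trans (ler_normB _ _))// lerD// ?ltW//.
    by have := By i; rewrite /= mxE.
  by rewrite [ltRHS](splitr e) ltrD.
apply: countable_bigcupT_measurable; first exact: countableP.
move=> p; rewrite /F; case: ifPn => // _; apply: measurable_box => i.
apply: open_measurable.
rewrite (_ : [set _ | _] = ball (ratr (p.1 ord0 i) : R) (p.2.+1%:R^-1)); first exact: ball_open.
by apply/seteqP; split => y; rewrite -ball_normE/= distrC.
Qed.

Lemma continuous_measurable_rV (f : 'rV[R]_n -> R) : continuous f ->
  measurable_fun setT f.
Proof.
move=> cf; apply: (measurability _ (RGenOInfty.measurableE R)).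
move=> /= _ [_ [a ->]] <-; apply: measurableI => //; apply: open_measurable_rV.
by apply: open_comp; [move=> x _; exact: cf|exact: interval_open].
Qed.

End continuous_measurable.

(** * The weight 1 + |x| *)

Section weight.
Variables (R : realType).

Lemma integral_oneDsqrV_lty :
  (\int[@lebesgue_measure R]_x ((oneDsqr x)^-1)%:E < +oo)%E.
Proof.
rewrite ge0_symfun_integralT//.
- rewrite -set_itvcy integral0y_oneDsqr -EFinM ltry//.
- exact: continuous_oneDsqrV.
- by move=> x /=; rewrite /oneDsqr sqrrN.
Qed.

Lemma measurable_prod_coor n (g : R -> R) : measurable_fun setT g ->
  measurable_fun setT (fun x : 'rV[R]_n => \prod_(i < n) g (x ord0 i)).
Proof.
move=> mg; apply: measurable_prod => i _.
by apply: (measurableT_comp mg); exact: measurable_coor.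
Qed.

(** Tonelli, peeling off the first coordinate. *)
Lemma integral_prod_coor_lty n (g : R -> R) : measurable_fun setT g ->
  (forall x, 0 <= g x) -> (\int[@lebesgue_measure R]_x (g x)%:E < +oo)%E ->
  (\int[lebesgue_rV R n]_x (\prod_(i < n) g (x ord0 i))%:E < +oo)%E.
Proof.
move=> mg g0 goo; elim: n => [|n IH].
  rewrite (eq_integral (cst 1%E)); last by move=> x _; rewrite big_ord0.
  by rewrite integral_cst// mul1e /= diracT ltry.
rewrite (ge0_integral_pushforward (@measurable_consrV R n))//=; first last.
- by move=> x _; rewrite lee_fin prodr_ge0.
- by apply/measurable_EFinP; exact: measurable_prod_coor.
rewrite preimage_setT fubini_tonelli1//=; first last.
- by move=> x; rewrite lee_fin prodr_ge0.
- apply/measurable_EFinP; apply: (measurableT_comp (@measurable_prod_coor _ _ mg)).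
  exact: measurable_consrV.
have -> : (fun x => fubini_F (lebesgue_rV R n)
   ((fun x0 => (\prod_(i < n.+1) g (x0 ord0 i))%:E) \o consrV (n:=n)) x) =
   (fun x => (g x)%:E * \int[lebesgue_rV R n]_y (\prod_(i < n) g (y ord0 i))%:E)%E.
  apply/funext => x; rewrite /fubini_F -ge0_integralZl//; first last.
  - by rewrite lee_fin.
  - by move=> y _; rewrite lee_fin prodr_ge0.
  - by apply/measurable_EFinP; exact: measurable_prod_coor.
  apply: eq_integral => y _ /=; rewrite -EFinM big_ord_recl !mxE unlift_none; congr (_ * _)%:E.
  by apply: eq_bigr => i _; rewrite mxE liftK.
have I0 : (0 <= \int[lebesgue_rV R n]_y (\prod_(i < n) g (y ord0 i))%:E)%E.
  by apply: integral_ge0 => y _; rewrite lee_fin prodr_ge0.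
rewrite ge0_integralZr//; first last.
- by move=> y _; rewrite lee_fin.
- exact/measurable_EFinP.
rewrite lte_mul_pinfty// ?integral_ge0//; first by move=> x _; rewrite lee_fin.
by rewrite ge0_fin_numE// integral_ge0//; move=> x _; rewrite lee_fin.
Qed.

Variable n : nat.
Local Notation mu := (lebesgue_rV R n).

Definition wt (x : 'rV[R]_n) : R := 1 + `|x|.

Lemma wt_ge1 x : 1 <= wt x. Proof. by rewrite /wt lerDl. Qed.
Lemma wt_gt0 x : 0 < wt x. Proof. exact: lt_le_trans ltr01 (wt_ge1 x). Qed.
Lemma wt_ge0 x : 0 <= wt x. Proof. exact/ltW/wt_gt0. Qed.

Lemma wtD x y : wt (x + y) <= wt x * wt y.
Proof.
rewrite /wt (le_trans (_ : _ <= 1 + (`|x| + `|y|)))// ?lerD2l ?ler_normD//.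
have := mulr_ge0 (normr_ge0 x) (normr_ge0 y); lra.
Qed.

Lemma measurable_wtV k : measurable_fun setT (fun x => wt x ^- k).
Proof.
have cw : continuous wt.
  move=> x; have h := @norm_continuous R 'rV[R]_n x.
  have c1 : {for x, continuous (fun=> 1 : R^o)} by exact: cst_continuous.
  exact: (@continuousD _ R^o _ _ _ _ c1 h).
apply: continuous_measurable_rV => x.
have e0 : wt x ^+ k != 0 by rewrite lt0r_neq0// exprn_gt0// wt_gt0.
apply: (@continuousV _ _ (fun x => wt x ^+ k) x e0).
exact: (continuous_comp (cw x) (@exprn_continuous R k (wt x))).
Qed.

(** (1 + |x|)^2 >= 1 + x_i^2 for each i, so the integrand is below the product
    of the functions 1 / (1 + x_i^2). *)
Lemma integral_wt_lty : (\int[mu]_x (wt x ^- (n.*2))%:E < +oo)%E.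
Proof.
have mg : measurable_fun setT (fun t : R => (oneDsqr t)^-1).
  by apply: continuous_measurable_fun; exact: continuous_oneDsqrV.
apply: le_lt_trans (@integral_prod_coor_lty n (fun t => (oneDsqr t)^-1) _ _ _).
- apply: ge0_le_integral => //.
  + by move=> x _; rewrite lee_fin invr_ge0 exprn_ge0// wt_ge0.
  + by apply/measurable_EFinP; exact: measurable_wtV.
  + by apply/measurable_EFinP; exact: (measurable_prod_coor mg).
  + move=> x _; rewrite lee_fin.
    have -> : wt x ^- n.*2 = \prod_(i < n) (wt x ^+ 2)^-1.
      by rewrite prodr_const card_ord exprVn -exprM mul2n.
    apply: ler_prod => i _; rewrite invr_ge0 exprn_ge0 ?wt_ge0//=.
    rewrite lef_pV2 ?posrE ?exprn_gt0 ?wt_gt0//.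
    rewrite /oneDsqr /wt -real_normK ?num_real//.
    have := coord_le_norm x i; have := normr_ge0 (x ord0 i); nra.
- exact: mg.
- by move=> x; rewrite invr_ge0 ltW// (lt_le_trans ltr01)// oneDsqr_ge1.
- exact: integral_oneDsqrV_lty.
Qed.

End weight.

(** * Complex-valued functions *)

Section normc_lemmas.
Variable R : realType.
Implicit Types (z w : R[i]) (a b : R).

Lemma normc_ge0 z : 0 <= normc z. Proof. by case: z => a b; exact: sqrtr_ge0. Qed.

Lemma le_Re_normc z : `|complex.Re z| <= normc z.
Proof. by case: z => a b /=; rewrite -sqrtr_sqr ler_wsqrtr// lerDl sqr_ge0. Qed.

Lemma le_Im_normc z : `|complex.Im z| <= normc z.
Proof. by case: z => a b /=; rewrite -sqrtr_sqr ler_wsqrtr// lerDr sqr_ge0. Qed.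

Lemma ReB z w : complex.Re (z - w) = complex.Re z - complex.Re w.
Proof. by case: z => ? ?; case: w. Qed.

Lemma ImB z w : complex.Im (z - w) = complex.Im z - complex.Im w.
Proof. by case: z => ? ?; case: w. Qed.

Lemma normc_real a : normc a%:C = `|a|.
Proof. by rewrite /= expr0n/= addr0 sqrtr_sqr. Qed.

Lemma normc_ReIm z : normc z <= `|complex.Re z| + `|complex.Im z|.
Proof.
case: z => a b /=; rewrite -[leRHS]ger0_norm ?addr_ge0// -sqrtr_sqr ler_wsqrtr//.
rewrite sqrrD !real_normK ?num_real// -addrA lerD2l lerDr mulrn_wge0 ?mulr_ge0//.
Qed.

Lemma normcD z w : normc (z + w) <= normc z + normc w.
Proof. exact: (@le_normcD R z w). Qed.

Lemma normc_opp z : normc (- z) = normc z.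
Proof. exact: (@normcN R z). Qed.

Lemma le_normcB z w : normc (z - w) <= normc z + normc w.
Proof. by rewrite (le_trans (normcD _ _))// normc_opp. Qed.

Lemma normc_conj z : normc (conjc z) = normc z.
Proof. by case: z => a b /=; rewrite sqrrN. Qed.

Lemma mulcC_conj z : z * conjc z = (normc z ^+ 2)%:C.
Proof.
case: z => a b; rewrite /= sqr_sqrtr ?addr_ge0 ?sqr_ge0//.
by apply/eqP; rewrite eq_complex /=; apply/andP; split; apply/eqP; ring.
Qed.

Lemma expiD a b : expi (a + b) = expi a * expi b.
Proof.
apply/eqP; rewrite eq_complex /= cosD sinD; apply/andP; split; apply/eqP; ring.
Qed.

Lemma expi0 : expi 0 = 1 :> R[i].
Proof. by rewrite /expi cos0 sin0. Qed.

Lemma normc_expi a : normc (expi a) = 1.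
Proof. by rewrite /= cos2Dsin2 sqrtr1. Qed.

Lemma conj_expi a : conjc (expi a) = expi (- a).
Proof. by rewrite /expi /= cosN sinN. Qed.

Lemma expipi : expi pi = -1 :> R[i].
Proof. by rewrite /expi cospi sinpi; apply/eqP; rewrite eq_complex /= oppr0 !eqxx. Qed.

Lemma MVT_le (f f' : R -> R) (h M : R) :
  (forall s, is_derive s (1 : R) f (f' s)) ->
  (forall s, `|s| <= `|h| -> `|f' s| <= M) -> `|f h - f 0| <= M * `|h|.
Proof.
move=> df f1.
have cf : continuous f.
  by move=> x; apply/differentiable_continuous/derivable1_diffP; have [] := df x.
have [h0|h0|->] := ltgtP h 0; last by rewrite subrr !normr0 mulr0.
- have [c] := @MVT_segment _ f f' h 0 (ltW h0) (fun x _ => df x)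
    (continuous_subspaceT cf).
  rewrite in_itv/= => /andP[hc c0].
  rewrite -normrN opprB => ->; rewrite sub0r normrM normrN ler_wpM2r// f1//.
  by rewrite !ler0_norm ?(ltW h0)// lerN2.
- have [c] := @MVT_segment _ f f' 0 h (ltW h0) (fun x _ => df x)
    (continuous_subspaceT cf).
  rewrite in_itv/= => /andP[c0 hc].
  by move=> ->; rewrite subr0 normrM ler_wpM2r// f1// !ger0_norm// ltW.
Qed.

(** The constant 2 comes from estimating the cosine and the sine separately. *)
Lemma normc_expiB1 a : normc (expi a - 1) <= 2 * `|a|.
Proof.
rewrite (le_trans (normc_ReIm _))//= mulr_natl mulr2n lerD//.
  rewrite -cos0 -[leRHS]mul1r; apply: (@MVT_le _ (fun x => - sin x)) => x _.
  by rewrite normrN ler_norml sin_geN1 sin_le1.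
rewrite -[X in _ - X]sin0 -[leRHS]mul1r; apply: (@MVT_le _ (fun x => cos x)) => x _.
by rewrite ler_norml cos_geN1 cos_le1.
Qed.

End normc_lemmas.

Section cmeasurable.
Context d (T : measurableType d) (R : realType).
Implicit Types (u v : T -> R[i]) (f : T -> R).

Definition cmeasurable u :=
  measurable_fun setT (fun x => complex.Re (u x)) /\
  measurable_fun setT (fun x => complex.Im (u x)).

Lemma cmeasurable_cst z : cmeasurable (fun=> z). Proof. by split. Qed.

Lemma cmeasurableD u v : cmeasurable u -> cmeasurable v ->
  cmeasurable (fun x => u x + v x).
Proof.
move=> [ur ui] [vr vi]; split.
  rewrite (_ : (fun _ => _) = (fun x => complex.Re (u x)) \+ (fun x => complex.Re (v x))).
    exact: measurable_funD.
  by apply/funext => x /=; case: (u x) => ? ?; case: (v x).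
rewrite (_ : (fun _ => _) = (fun x => complex.Im (u x)) \+ (fun x => complex.Im (v x))).
  exact: measurable_funD.
by apply/funext => x /=; case: (u x) => ? ?; case: (v x).
Qed.

Lemma cmeasurableM u v : cmeasurable u -> cmeasurable v ->
  cmeasurable (fun x => u x * v x).
Proof.
move=> [ur ui] [vr vi]; split.
  rewrite (_ : (fun _ => _) = (fun x => complex.Re (u x) * complex.Re (v x) -
      complex.Im (u x) * complex.Im (v x))).
    by apply: measurable_funB; exact: measurable_funM.
  by apply/funext => x /=; case: (u x) => ? ?; case: (v x).
rewrite (_ : (fun _ => _) = (fun x => complex.Re (u x) * complex.Im (v x) +
    complex.Im (u x) * complex.Re (v x))).
  by apply: measurable_funD; exact: measurable_funM.
by apply/funext => x /=; case: (u x) => ? ?; case: (v x).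
Qed.

Lemma cmeasurableB u v : cmeasurable u -> cmeasurable v ->
  cmeasurable (fun x => u x - v x).
Proof.
move=> mu mv; rewrite (_ : (fun _ => _) = (fun x => u x + -1 * v x)).
  by apply: cmeasurableD => //; exact: (cmeasurableM (cmeasurable_cst (-1)) mv).
by apply/funext => x; rewrite mulN1r.
Qed.

Lemma cmeasurable_conj u : cmeasurable u -> cmeasurable (fun x => conjc (u x)).
Proof.
move=> [ur ui]; split.
  rewrite (_ : (fun _ => _) = (fun x => complex.Re (u x)))//.
  by apply/funext => x; case: (u x).
rewrite (_ : (fun _ => _) = (fun x => - complex.Im (u x))); first exact: measurable_funN.
by apply/funext => x; case: (u x).
Qed.

Lemma cmeasurable_real f : measurable_fun setT f -> cmeasurable (fun x => (f x)%:C).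
Proof. by move=> mf; split. Qed.

Lemma cmeasurable_expi f : measurable_fun setT f -> cmeasurable (fun x => expi (f x)).
Proof.
move=> mf.
have mc : measurable_fun setT (@cos R).
  by apply: continuous_measurable_fun; exact: continuous_cos.
have ms : measurable_fun setT (@sin R).
  by apply: continuous_measurable_fun; exact: continuous_sin.
by split; [exact: (measurableT_comp mc mf)|exact: (measurableT_comp ms mf)].
Qed.

End cmeasurable.

Lemma cmeasurable_comp d (T : measurableType d) d' (T' : measurableType d') (R : realType)
  (u : T -> R[i]) (h : T' -> T) :
  cmeasurable u -> measurable_fun setT h -> cmeasurable (fun x => u (h x)).
Proof.
move=> [ur ui] mh.
by split; [exact: (measurableT_comp ur mh)|exact: (measurableT_comp ui mh)].
Qed.

(** * Integrals of dominated functions *)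

Section cintegral_theory.
Variables (R : realType) (n : nat).
Local Notation mu := (lebesgue_rV R n).
Local Notation V := 'rV[R]_n.
Implicit Types (u v : V -> R[i]) (f : V -> R) (C D : R).

Definition wtmass : R := fine (\int[mu]_x (wt x ^- (n.*2))%:E).

(** Every integral below is dominated by the one integrable weight (1 +
    |x|)^(-2 n). A bound by C times this weight yields the absolute
    convergence, an explicit estimate of the integral, and the hypothesis of
    Fubini. *)
Definition dominated u C :=
  cmeasurable u /\ forall x, normc (u x) <= C * wt x ^- (n.*2).

Lemma wtV_ge0 k (x : V) : 0 <= wt x ^- k.
Proof. by rewrite invr_ge0 exprn_ge0// wt_ge0. Qed.

Lemma wtmass_ge0 : 0 <= wtmass.
Proof. by apply: fine_ge0; apply: integral_ge0 => x _; rewrite lee_fin wtV_ge0. Qed.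

Lemma integral_wtE : (\int[mu]_x (wt x ^- (n.*2))%:E = wtmass%:E)%E.
Proof.
rewrite fineK// ge0_fin_numE ?integral_wt_lty//.
by apply: integral_ge0 => x _; rewrite lee_fin wtV_ge0.
Qed.

Lemma dom_integrable f C : measurable_fun setT f ->
  (forall x, `|f x| <= C * wt x ^- (n.*2)) ->
  mu.-integrable setT (fun x => (f x)%:E).
Proof.
move=> mf fC.
have mw : measurable_fun setT (fun x : V => (C * wt x ^- (n.*2))%:E).
  by apply/measurable_EFinP/measurable_funM => //; exact: measurable_wtV.
apply: (@le_integrable _ _ _ _ _ _ _ (fun x => (C * wt x ^- (n.*2))%:E)) => //.
- exact/measurable_EFinP.
- by move=> x _; rewrite !abse_EFin lee_fin (le_trans (fC x))// ler_norm.
apply: (@integrableZl _ _ _ _ _ measurableT C (fun x => (wt x ^- (n.*2))%:E)).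
apply/integrableP; split; first by apply/measurable_EFinP; exact: measurable_wtV.
under eq_integral do rewrite gee0_abs ?lee_fin ?wtV_ge0//.
exact: integral_wt_lty.
Qed.

Lemma le_dom_Rintegral f C : measurable_fun setT f ->
  (forall x, `|f x| <= C * wt x ^- (n.*2)) ->
  `|\int[mu]_x f x| <= C * wtmass.
Proof.
move=> mf fC; have If := dom_integrable mf fC.
rewrite (le_trans (le_normr_Rintegral measurableT If))//.
have -> : C * wtmass = \int[mu]_x (C * wt x ^- n.*2).
  rewrite RintegralZl//.
  apply: (@dom_integrable _ 1); first exact: measurable_wtV.
  by move=> x; rewrite mul1r ger0_norm// wtV_ge0.
apply: le_Rintegral => //.
- exact: (integrable_norm If).
- apply: (@dom_integrable _ `|C|).
    by apply: measurable_funM => //; exact: measurable_wtV.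
  by move=> x; rewrite normrM (ger0_norm (wtV_ge0 _ _)).
Qed.

Lemma dominated_ge0 u C : dominated u C -> 0 <= C.
Proof.
move=> [_ /(_ 0)]; move/(le_trans (normc_ge0 _)).
by rewrite /wt normr0 addr0 expr1n invr1 mulr1.
Qed.

Lemma dominated_Re u C : dominated u C ->
  measurable_fun setT (fun x => complex.Re (u x)) /\
  forall x, `|complex.Re (u x)| <= C * wt x ^- n.*2.
Proof. by move=> [[mr _] uC]; split => // x; rewrite (le_trans (le_Re_normc _)). Qed.

Lemma dominated_Im u C : dominated u C ->
  measurable_fun setT (fun x => complex.Im (u x)) /\
  forall x, `|complex.Im (u x)| <= C * wt x ^- n.*2.
Proof. by move=> [[_ mi] uC]; split => // x; rewrite (le_trans (le_Im_normc _)). Qed.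

Lemma dominated_iRe u C : dominated u C ->
  mu.-integrable setT (EFin \o (fun x => complex.Re (u x))).
Proof. by move=> /dominated_Re[m b]; exact: dom_integrable b. Qed.

Lemma dominated_iIm u C : dominated u C ->
  mu.-integrable setT (EFin \o (fun x => complex.Im (u x))).
Proof. by move=> /dominated_Im[m b]; exact: dom_integrable b. Qed.

(** The factor 2 is the price of treating real and imaginary parts separately. *)
Lemma normc_cintegral u C : dominated u C -> normc (cintegral u) <= 2 * C * wtmass.
Proof.
move=> du; rewrite (le_trans (normc_ReIm _))//= -mulrA mulr_natl mulr2n lerD//.
  by have [m b] := dominated_Re du; exact: le_dom_Rintegral.
by have [m b] := dominated_Im du; exact: le_dom_Rintegral.
Qed.

Lemma dominatedB u v C D : dominated u C -> dominated v D ->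
  dominated (fun x => u x - v x) (C + D).
Proof.
move=> [mu_ uC] [mv vD]; split; first exact: cmeasurableB.
by move=> x; rewrite mulrDl (le_trans (le_normcB _ _))// lerD.
Qed.

Lemma dominatedM u v C D : dominated u C -> cmeasurable v ->
  (forall x, normc (v x) <= D) ->
  dominated (fun x => v x * u x) (D * C).
Proof.
move=> [mu_ uC] mv vD; split; first exact: cmeasurableM.
by move=> x; rewrite Normc.normcM -mulrA ler_pM// normc_ge0.
Qed.

Lemma dominatedZ u C (z : R[i]) : dominated u C ->
  dominated (fun x => z * u x) (normc z * C).
Proof. by move=> du; apply: dominatedM => //; exact: cmeasurable_cst. Qed.

Lemma cintegralD u v C D : dominated u C -> dominated v D ->
  cintegral (fun x => u x + v x) = cintegral u + cintegral v.
Proof.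
move=> du dv; rewrite /cintegral; apply/eqP; rewrite eq_complex /=.
rewrite -RintegralD//; [|exact: dominated_iRe du|exact: dominated_iRe dv].
rewrite -RintegralD//; [|exact: dominated_iIm du|exact: dominated_iIm dv].
by apply/andP; split; apply/eqP; congr Rintegral; apply/funext => x;
  case: (u x) => ? ?; case: (v x).
Qed.

Lemma cintegralZ u C (z : R[i]) : dominated u C ->
  cintegral (fun x => z * u x) = z * cintegral u.
Proof.
move=> du; have ir := dominated_iRe du; have ii := dominated_iIm du.
case: z => a b; rewrite /cintegral; apply/eqP; rewrite eq_complex /=.
rewrite -!RintegralZl//.
rewrite -RintegralB//; [|exact: integrableZl ir|exact: integrableZl ii].
rewrite -RintegralD//; [|exact: integrableZl ii|exact: integrableZl ir].
by apply/andP; split; apply/eqP; congr Rintegral; apply/funext => x;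
  case: (u x) => ? ?.
Qed.

Lemma cintegralB u v C D : dominated u C -> dominated v D ->
  cintegral (fun x => u x - v x) = cintegral u - cintegral v.
Proof.
move=> du dv; rewrite -mulN1r -(cintegralZ _ dv) -(cintegralD du (dominatedZ (-1) dv)).
by congr cintegral; apply/funext => x; rewrite mulN1r.
Qed.

Lemma ge0_integral_affine (a : V) (s : R) (f : V -> \bar R) : s != 0 ->
  measurable_fun setT f -> (forall x, 0 <= f x)%E ->
  (\int[mu]_x f (affine a s x) = (`|s|^- n)%:E * \int[mu]_x f x)%E.
Proof.
move=> s0 mf f0.
have k0 : 0 <= `|s|^- n by rewrite invr_ge0 exprn_ge0.
pose k : {nonneg R} := NngNum k0.
rewrite -[RHS](ge0_integral_mscale mu measurableT k mf)//.
rewrite -[LHS](ge0_integral_pushforward (@measurable_affine _ _ a s) mu measurableT mf)//.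
apply: eq_measure_integral => [|mm A mA _]; first exact: measurable_affine.
exact: (lebesgue_rV_affine a s0 mA).
Qed.

Lemma Rintegral_affine (a : V) (s : R) f : s != 0 ->
  mu.-integrable setT (fun x => (f x)%:E) ->
  \int[mu]_x f x = `|s| ^+ n * \int[mu]_x f (affine a s x).
Proof.
move=> s0 If; have mf : measurable_fun setT (fun x => (f x)%:E) := measurable_int mu If.
rewrite /Rintegral.
have sn0 : `|s| ^+ n != 0 by rewrite expf_neq0// normr_eq0.
suff -> : (\int[mu]_x (f (affine a s x))%:E = (`|s| ^- n)%:E * \int[mu]_x (f x)%:E)%E.
  by rewrite fineM//= ?integrable_fin_num// mulrA divff// mul1r.
rewrite integralE [in RHS]integralE muleBr//; last first.
  by rewrite fin_num_adde_defl// fin_numN integrable_neg_fin_num.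
rewrite -!(ge0_integral_affine a s0)//; [|exact: measurable_funeneg|exact: measurable_funepos].
congr (_ - _)%E; apply: eq_integral => x _.
  exact: (congr1 (fun g => g x) (funepos_comp (fun y => (f y)%:E) (affine a s))).
exact: (congr1 (fun g => g x) (funeneg_comp (fun y => (f y)%:E) (affine a s))).
Qed.

Lemma cintegral_affine (a : V) (s : R) u C : s != 0 -> dominated u C ->
  cintegral u = (`|s| ^+ n)%:C * cintegral (fun z => u (affine a s z)).
Proof.
move=> s0 du; have ir := dominated_iRe du; have ii := dominated_iIm du.
rewrite /cintegral (Rintegral_affine a s0 ir) (Rintegral_affine a s0 ii).
by apply/eqP; rewrite eq_complex /= !mul0r subr0 addr0 !eqxx.
Qed.

End cintegral_theory.

Section cFubini.
Variables (R : realType) (n : nat).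
Local Notation mu := (lebesgue_rV R n).
Local Notation V := 'rV[R]_n.

Lemma Rintegral_swap (f : V * V -> R) (C : R) : measurable_fun setT f ->
  (forall x y, `|f (x, y)| <= C * wt x ^- n.*2 * wt y ^- n.*2) ->
  \int[mu]_x \int[mu]_y f (x, y) = \int[mu]_y \int[mu]_x f (x, y).
Proof.
move=> mf fC.
have mf1 x : measurable_fun setT (fun y => f (x, y)) by exact: measurableT_comp.
have mf2 y : measurable_fun setT (fun x => f (x, y)) by exact: measurableT_comp.
have If : (mu \x mu)%E.-integrable setT (EFin \o f).
  apply/integrable12ltyP; first exact/measurable_EFinP.
  apply: (@le_lt_trans _ _ (\int[mu]_x (C * wtmass R n * wt x ^- n.*2)%:E)%E); last first.
    rewrite ltey_eq; apply/orP; left; apply: integrable_fin_num => //.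
    apply: (@dom_integrable _ _ _ `|C * wtmass R n|).
      by apply: measurable_funM => //; exact: measurable_wtV.
    by move=> x; rewrite normrM (ger0_norm (wtV_ge0 _ _)).
  apply: ge0_le_integral => //.
  - by move=> x _; apply: integral_ge0.
  - apply: (measurable_fun_fubini_tonelli_F (fun p => `|(f p)%:E|%E)) => //.
    apply: (@measurableT_comp _ _ _ _ _ _ abse _ (fun p => (f p)%:E)) => //.
    exact/measurable_EFinP.
  - by apply/measurable_EFinP/measurable_funM => //; exact: measurable_wtV.
  move=> x _.
  have mn : measurable_fun setT (fun y => `|f (x, y)|).
    exact: (measurableT_comp (@normr_measurable R setT) (mf1 x)).
  have nC y : `| `|f (x, y)| | <= C * wt x ^- n.*2 * wt y ^- n.*2 by rewrite normr_id.
  have In := dom_integrable mn nC; have := le_dom_Rintegral mn nC.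
  rewrite ger0_norm ?Rintegral_ge0// -lee_fin fineK ?integrable_fin_num//.
  by rewrite mulrAC.
have fE1 x : (\int[mu]_y f (x, y))%:E = (\int[mu]_y (f (x, y))%:E)%E.
  rewrite fineK//; apply: integrable_fin_num => //.
  exact: (@dom_integrable _ _ _ (C * wt x ^- n.*2)).
have fE2 y : (\int[mu]_x f (x, y))%:E = (\int[mu]_x (f (x, y))%:E)%E.
  rewrite fineK//; apply: integrable_fin_num => //.
  apply: (@dom_integrable _ _ _ (C * wt y ^- n.*2)) => // x.
  by rewrite mulrAC.
rewrite /Rintegral; congr fine.
under eq_integral do rewrite fE1.
under [RHS]eq_integral do rewrite fE2.
exact: (Fubini If).
Qed.

Lemma cintegral_swap (K : V -> V -> R[i]) (C : R) :
  cmeasurable (fun p : V * V => K p.1 p.2) ->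
  (forall x y, normc (K x y) <= C * wt x ^- n.*2 * wt y ^- n.*2) ->
  cintegral (fun x => cintegral (K x)) = cintegral (fun y => cintegral (K ^~ y)).
Proof.
move=> [mr mi] KC; rewrite /cintegral /=; congr (_ +i* _).
  apply: (@Rintegral_swap (fun p => complex.Re (K p.1 p.2)) C) => // x y.
  by rewrite (le_trans (le_Re_normc _)).
apply: (@Rintegral_swap (fun p => complex.Im (K p.1 p.2)) C) => // x y.
by rewrite (le_trans (le_Im_normc _)).
Qed.

End cFubini.

(** * Scalar product and rapid decrease *)

Section dotp.
Variables (R : realType) (n : nat).
Local Notation V := 'rV[R]_n.
Implicit Types (x y z : V) (a : R).

Lemma dotpDl x y z : dotp (x + y) z = dotp x z + dotp y z.
Proof. by rewrite /dotp -big_split; apply: eq_bigr => i _; rewrite mxE mulrDl. Qed.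

Lemma dotpC x y : dotp x y = dotp y x.
Proof. by apply: eq_bigr => i _; rewrite mulrC. Qed.

Lemma dotpZl a x y : dotp (a *: x) y = a * dotp x y.
Proof. by rewrite /dotp mulr_sumr; apply: eq_bigr => i _; rewrite mxE mulrA. Qed.

Lemma dotpDr x y z : dotp z (x + y) = dotp z x + dotp z y.
Proof. by rewrite dotpC dotpDl !(dotpC z). Qed.

Lemma dotpZr a x y : dotp y (a *: x) = a * dotp y x.
Proof. by rewrite dotpC dotpZl (dotpC y). Qed.

Lemma dotpNl x y : dotp (- x) y = - dotp x y.
Proof. by rewrite -scaleN1r dotpZl mulN1r. Qed.

Lemma dotpNr x y : dotp y (- x) = - dotp y x.
Proof. by rewrite dotpC dotpNl dotpC. Qed.

Lemma dotp_basis (i : 'I_n) x : dotp (basis_rV R i) x = x ord0 i.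
Proof.
rewrite /dotp (bigD1 i)//= big1 => [|j ji]; last by rewrite !mxE (negbTE ji) andbF mul0r.
by rewrite !mxE !eqxx mul1r addr0.
Qed.

Lemma le_dotp x y : `|dotp x y| <= n%:R * `|x| * `|y|.
Proof.
rewrite /dotp (le_trans (ler_norm_sum _ _ _))//.
rewrite (@le_trans _ _ (\sum_(i < n) `|x| * `|y|))//.
  by apply: ler_sum => i _; rewrite normrM ler_pM// coord_le_norm.
by rewrite sumr_const card_ord -mulrA mulr_natl.
Qed.

Lemma dotpp_ge0 x : 0 <= dotp x x.
Proof. by apply: sumr_ge0 => i _; rewrite -expr2 sqr_ge0. Qed.

Lemma measurable_dotp : measurable_fun setT (fun p : V * V => dotp p.1 p.2).
Proof.
apply: measurable_sum => i; apply: measurable_funM.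
  exact: (measurableT_comp (@measurable_coor R n i) measurable_fst).
exact: (measurableT_comp (@measurable_coor R n i) measurable_snd).
Qed.

Lemma measurable_dotpl y : measurable_fun setT (fun x : V => dotp x y).
Proof.
by apply: measurable_sum => i; apply: measurable_funM => //; exact: measurable_coor.
Qed.

Lemma norm_basis (i : 'I_n) : `|basis_rV R i| <= 1.
Proof.
apply: norm_rV_le => // j; rewrite !mxE eqxx /=.
by case: (j == i); rewrite ?normr1 ?normr0.
Qed.

End dotp.

Section rapid.
Variables (R : realType) (n : nat).
Local Notation V := 'rV[R]_n.
Implicit Types (u v : V -> R[i]) (x xi : V).

Definition rapid u :=
  cmeasurable u /\ forall k, exists C : R, forall x, normc (u x) <= C * wt x ^- k.

(** If |x| <= 1 the weight is at most 2; otherwise 1 + |x| <= 2 |x_j| for some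
    j. So decay can be tested on powers of the single coordinates, which is
    the form in which both the Schwartz seminorms and the Fourier estimates
    come. *)
Lemma le_wtV (g : V -> R) k : (forall x, 0 <= g x) ->
  (exists C, forall x, g x <= C) ->
  (forall j, exists C, forall x, g x * `|x ord0 j| ^+ k <= C) ->
  exists C : R, forall x, g x <= C * wt x ^- k.
Proof.
move=> g0 [C0 gC0] /choice[C gC].
have C00 : 0 <= C0 by exact: le_trans (g0 0) (gC0 0).
have Cj0 j : 0 <= C j by apply: le_trans (gC j 0); rewrite mulr_ge0// exprn_ge0.
exists (2 ^+ k * (C0 + \sum_j C j)) => x.
rewrite ler_pdivlMr ?exprn_gt0 ?wt_gt0//.
have [x1|x1] := leP `|x| 1.
  rewrite mulrC ler_pM ?exprn_ge0 ?wt_ge0//.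
    by rewrite lerXn2r ?nnegrE ?wt_ge0// /wt; lra.
  by rewrite (le_trans (gC0 x))// lerDl sumr_ge0.
have [j xj] : exists j, `|x| = `|x ord0 j|.
  have x0 : mx_norm x != 0 by rewrite -/(Num.norm x) gt_eqF// (lt_trans ltr01).
  have [[i j] xE] := mx_norm_neq0 x0; exists j.
  by rewrite -[LHS]/(mx_norm x) xE /= (ord1 i).
have wx : wt x <= 2 * `|x ord0 j| by rewrite /wt -xj; lra.
rewrite (@le_trans _ _ (g x * (2 * `|x ord0 j|) ^+ k))//.
  by rewrite ler_wpM2l// lerXn2r ?nnegrE ?wt_ge0// mulr_ge0.
rewrite exprMn mulrCA ler_wpM2l ?exprn_ge0// (le_trans (gC j x))//.
by rewrite (bigD1 j)//= addrCA lerDl addr_ge0// sumr_ge0.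
Qed.

Lemma rapid_dominated u : rapid u -> exists C, dominated u C.
Proof. by move=> [mu /(_ n.*2)[C uC]]; exists C. Qed.

(** Rapid decrease absorbs a polynomial factor and still leaves the integrable
    weight. *)
Lemma rapid_wt u k : rapid u -> exists C : R, 0 <= C /\
  forall x, normc (u x) * wt x ^+ k <= C * wt x ^- n.*2.
Proof.
move=> [_ /(_ (k + n.*2)%N)[C uC]]; exists C; split.
  have := le_trans (normc_ge0 _) (uC 0).
  by rewrite /wt normr0 addr0 expr1n invr1 mulr1.
move=> x; rewrite -ler_pdivlMr ?exprn_gt0 ?wt_gt0//.
by rewrite -mulrA -invfM -exprD addnC.
Qed.

(** From wt x <= wt (- a) * wt (a + x). *)
Lemma wt_shift (a x : V) k : wt (a + x) ^- k <= wt a ^+ k * wt x ^- k.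
Proof.
rewrite ler_pdivlMr ?exprn_gt0 ?wt_gt0// mulrC ler_pdivrMr ?exprn_gt0 ?wt_gt0//.
rewrite -exprMn lerXn2r ?nnegrE ?mulr_ge0 ?wt_ge0//.
have := wtD (- a) (a + x); rewrite addKr.
by rewrite [X in X * _]/wt normrN.
Qed.

Lemma wt_affine (a x : V) (s : R) k : s != 0 ->
  wt (affine a s x) ^- k <= ((1 + `|s^-1|) * wt a) ^+ k * wt x ^- k.
Proof.
move=> s0; rewrite ler_pdivlMr ?exprn_gt0 ?wt_gt0// mulrC ler_pdivrMr ?exprn_gt0 ?wt_gt0//.
have s1 : 0 <= 1 + `|s^-1| by rewrite addr_ge0.
rewrite -exprMn lerXn2r ?nnegrE ?mulr_ge0 ?wt_ge0//.
have xE : x = s^-1 *: (- a + affine a s x) by rewrite /affine addKr scalerA mulVf// scale1r.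
have := wtD (- a) (affine a s x); rewrite [X in X * _]/wt normrN -/(wt a).
move: xE; set y := affine a s x => xE aE; rewrite -mulrA.
apply: le_trans (ler_wpM2l s1 aE); rewrite {1}xE /wt normrZ mulrDr mulr1.
have := normr_ge0 s^-1; have := normr_ge0 (- a + y); nra.
Qed.

Lemma dominated_affine u C (a : V) (s : R) : s != 0 -> dominated u C ->
  dominated (fun x => u (affine a s x)) (C * ((1 + `|s^-1|) * wt a) ^+ n.*2).
Proof.
move=> s0 du; have C0 := dominated_ge0 du; case: du => mu uC; split.
  exact: (cmeasurable_comp mu (measurable_affine a s)).
by move=> x; rewrite (le_trans (uC _))// -mulrA ler_wpM2l// wt_affine.
Qed.

Lemma rapid_affine u (a : V) (s : R) : s != 0 -> rapid u ->
  rapid (fun x => u (affine a s x)).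
Proof.
move=> s0 [mu uC]; split; first exact: (cmeasurable_comp mu (measurable_affine a s)).
move=> k; have [C HC] := uC k; exists (C * ((1 + `|s^-1|) * wt a) ^+ k) => x.
have C0 : 0 <= C.
  have := le_trans (normc_ge0 _) (HC 0).
  by rewrite /wt normr0 addr0 expr1n invr1 mulr1.
by rewrite (le_trans (HC _))// -mulrA ler_wpM2l// wt_affine.
Qed.

End rapid.

Section line_derivative.
Variables (R : realType) (n : nat).
Local Notation V := 'rV[R]_n.

Lemma is_derive_line (f : V -> R) (df : V -> R) (x v : V) (s : R) :
  (forall y, is_derive y v f (df y)) ->
  is_derive s (1 : R) (fun s => f (x + s *: v)) (df (x + s *: v)).
Proof.
move=> /(_ (x + s *: v))[fd fE].
have E : (fun h : R => h^-1 *: (((fun s => f (x + s *: v)) \o shift s) (h *: 1) -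
             (fun s => f (x + s *: v)) s)) =
         (fun h : R => h^-1 *: ((f \o shift (x + s *: v)) (h *: v) - f (x + s *: v))).
  apply/funext => h /=; congr (_ *: (f _ - _)).
  by rewrite scalerDl addrCA /GRing.scale /= mulr1.
apply: DeriveDef.
  by rewrite /derivable E.
by rewrite -fE /derive E.
Qed.

End line_derivative.

(** * Translation differences and the Fourier transform *)

Section fourier_basic.
Variables (R : realType) (n : nat).
Local Notation V := 'rV[R]_n.
Implicit Types (u v : V -> R[i]) (x xi : V).

Lemma dominated_expi u C (f : V -> R) : measurable_fun setT f -> dominated u C ->
  dominated (fun x => expi (f x) * u x) C.
Proof.
move=> mf du; rewrite -[C]mul1r; apply: dominatedM => //; first exact: cmeasurable_expi.
by move=> x; rewrite normc_expi.
Qed.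

Lemma measurable_fdotp xi : measurable_fun setT (fun x : V => - (2 * pi * dotp x xi)).
Proof.
by apply: measurable_funN; apply: measurable_funM => //; exact: measurable_dotpl.
Qed.

Lemma dominated_fourier u C xi : dominated u C ->
  dominated (fun x => expi (- (2 * pi * dotp x xi)) * u x) C.
Proof. by move=> du; apply: dominated_expi => //; exact: measurable_fdotp. Qed.

Lemma dominated_shift u C (a : V) : dominated u C ->
  dominated (fun x => u (a + x)) (C * wt a ^+ n.*2).
Proof.
move=> du; have C0 := dominated_ge0 du; case: du => mu uC; split.
  have ma : measurable_fun setT (fun x : V => a + x).
    have := @measurable_affine R n a 1.
    by rewrite /affine; under eq_fun do rewrite scale1r.
  exact: (cmeasurable_comp mu ma).
move=> x; rewrite (le_trans (uC _))// -mulrA ler_wpM2l// wt_shift//.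
Qed.

Lemma fourier_shift u C (a : V) xi : dominated u C ->
  fourier (fun x => u (a + x)) xi = expi (2 * pi * dotp a xi) * fourier u xi.
Proof.
move=> du; rewrite {2}/fourier (cintegral_affine a (oner_neq0 R) (dominated_fourier xi du)).
rewrite normr1 expr1n mul1r.
rewrite -(cintegralZ _ (C := C * wt a ^+ n.*2)); last first.
  have := dominated_shift a (dominated_fourier xi du).
  by rewrite /affine; under [in X in _ -> X]eq_fun do rewrite scale1r.
congr cintegral; apply/funext => x.
by rewrite /affine scale1r [RHS]mulrA -expiD dotpDl; congr (expi _ * _); ring.
Qed.

End fourier_basic.

Section finite_differences.
Variables (R : realType) (n : nat).
Local Notation V := 'rV[R]_n.
Implicit Types (U : nat -> V -> R[i]) (x v xi : V) (h : R).

(** U i is the i-th derivative of U 0 in the direction v. Having all of them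
    in one sequence lets a translation difference act on the whole chain, as
    the induction of fourier_chain_decay requires. *)
Definition derivative_chain v U :=
  (forall i, exists C, dominated (U i) C) /\
  (forall i x, is_derive x v (fun y => complex.Re (U i y)) (complex.Re (U i.+1 x)) /\
               is_derive x v (fun y => complex.Im (U i y)) (complex.Im (U i.+1 x))).

Lemma chain_shift v U h : derivative_chain v U ->
  derivative_chain v (fun i x => U i (h *: v + x) - U i x).
Proof.
move=> [dU dd]; split.
  move=> i; have [C dC] := dU i.
  exists (C * wt (h *: v) ^+ n.*2 + C).
  by apply: dominatedB => //; exact: dominated_shift.
have sh (f df : V -> R) x : (forall y, is_derive y v f (df y)) ->
    is_derive x v (fun y => f (h *: v + y)) (df (h *: v + x)).
  move=> /(_ (h *: v + x))[fd fE].
  have E : (fun k : R => k^-1 *: (((fun y => f (h *: v + y)) \o shift x) (k *: v) -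
             f (h *: v + x))) =
           (fun k : R => k^-1 *: ((f \o shift (h *: v + x)) (k *: v) - f (h *: v + x))).
    by apply/funext => k /=; congr (_ *: (f _ - _)); rewrite addrCA.
  by apply: DeriveDef; [rewrite /derivable E|rewrite -fE /derive E].
move=> i x; split.
  rewrite ReB; under eq_fun do rewrite ReB.
  exact: is_deriveB (sh _ _ x (fun y => (dd i y).1)) (dd i x).1.
rewrite ImB; under eq_fun do rewrite ImB.
exact: is_deriveB (sh _ _ x (fun y => (dd i y).2)) (dd i x).2.
Qed.

(** Mean value theorem on the segment from x to x + h v, on which the weights
    are comparable since |h v| <= 1. *)
Lemma chain_diff_le v U h i A x : derivative_chain v U -> `|v| <= 1 -> `|h| <= 1 ->
  (forall y, normc (U i.+1 y) <= A * wt y ^- n.*2) ->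
  normc (U i (h *: v + x) - U i x) <= (2 * 2 ^+ n.*2 * `|h|) * A * wt x ^- n.*2.
Proof.
move=> [_ dd] v1 h1 UA.
have A0 : 0 <= A.
  have := le_trans (normc_ge0 _) (UA 0).
  by rewrite /wt normr0 addr0 expr1n invr1 mulr1.
have UA' s : `|s| <= `|h| -> normc (U i.+1 (x + s *: v)) <= A * 2 ^+ n.*2 * wt x ^- n.*2.
  move=> sh; rewrite (le_trans (UA _))// -mulrA ler_wpM2l// addrC.
  rewrite (le_trans (wt_shift _ _ _))// ler_wpM2r ?wtV_ge0// lerXn2r ?nnegrE ?wt_ge0//.
  have : `|s *: v| <= 1 by rewrite normrZ mulr_ile1// (le_trans sh).
  by rewrite /wt; lra.
have key (p : R[i] -> R) : (forall z, `|p z| <= normc z) ->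
    (forall y, is_derive y v (fun y => p (U i y)) (p (U i.+1 y))) ->
    `|p (U i (h *: v + x)) - p (U i x)| <= A * 2 ^+ n.*2 * wt x ^- n.*2 * `|h|.
  move=> pn pd.
  have := @MVT_le R (fun s => p (U i (x + s *: v))) (fun s => p (U i.+1 (x + s *: v))) h
    (A * 2 ^+ n.*2 * wt x ^- n.*2) (fun s => is_derive_line x s pd).
  rewrite /= scale0r addr0 [h *: v + x]addrC => H; apply: H => s sh.
  by rewrite (le_trans (pn _))// UA'.
have := key _ (@le_Re_normc R) (fun y => (dd i y).1).
have := key _ (@le_Im_normc R) (fun y => (dd i y).2).
rewrite (_ : 2 * _ * _ * _ * _ = A * 2 ^+ n.*2 * wt x ^- n.*2 * `|h| +
  A * 2 ^+ n.*2 * wt x ^- n.*2 * `|h|); last by ring.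
move=> ki kr; rewrite (le_trans (normc_ReIm _))// lerD//.
  by rewrite ReB.
by rewrite ImB.
Qed.

(** When h (v . xi) = 1/2, translation by h v changes the sign of the
    transform at xi, so the difference u (h v + x) - u x has there the
    transform - 2 F u. The difference is O(|h|) by the mean value theorem, and
    iterating K times gains |h|^K. *)
Lemma fourier_chain_decay v h xi K U A : derivative_chain v U -> `|v| <= 1 -> `|h| <= 1 ->
  expi (2 * pi * dotp (h *: v) xi) = -1 ->
  (forall x, normc (U K x) <= A * wt x ^- n.*2) ->
  normc (fourier (U 0) xi) <= (2 * 2 ^+ n.*2 * `|h|) ^+ K * (2 * A * wtmass R n).
Proof.
move=> + v1 h1 hxi; elim: K U A => [|K IH] U A cU UA.
  rewrite mul1r; apply: normc_cintegral; apply: dominated_fourier.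
  by split => //; have [C []] := cU.1 0%N.
pose U' i x := U i (h *: v + x) - U i x.
have cU' : derivative_chain v U' by exact: chain_shift.
have := IH U' _ cU' (fun x => chain_diff_le x cU v1 h1 UA).
have [C dC] := cU.1 0%N.
have -> : fourier (U' 0%N) xi = (- 2%:R%:C) * fourier (U 0%N) xi.
  transitivity (fourier (fun x => U 0%N (h *: v + x)) xi - fourier (U 0%N) xi).
    rewrite /fourier -(cintegralB (dominated_fourier xi (dominated_shift (h *: v) dC))
      (dominated_fourier xi dC)).
    by congr cintegral; apply/funext => x; rewrite -mulrBr.
  rewrite (fourier_shift _ _ dC) hxi -[X in _ - X]mul1r -mulrBl; congr (_ * _).
  by rewrite rmorphD/= rmorph1 opprD.
rewrite Normc.normcM normc_opp normc_real ger0_norm//.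
have := normc_ge0 (fourier (U 0%N) xi).
rewrite exprS (_ : _ ^+ K * _ = (2 * 2 ^+ n.*2 * `|h| * (2 * 2 ^+ n.*2 * `|h|) ^+ K) *
  (2 * A * wtmass R n)); last by ring.
lra.
Qed.

End finite_differences.

(** * Fourier transform of a Schwartz function *)

Section schwartz_rapid.
Variables (R : realType) (n : nat).
Local Notation V := 'rV[R]_n.
Implicit Types (u phi : V -> R[i]) (x xi : V).

Definition single (j : 'I_n) (k : nat) : multi_index n :=
  [ffun i => if i == j then k else 0%N].

Lemma mmonomial_single j k x : mmonomial (single j k) x = x ord0 j ^+ k.
Proof.
rewrite /mmonomial (bigD1 j)//= ffunE eqxx big1 ?mulr1// => i ij.
by rewrite ffunE (negbTE ij) expr0.
Qed.

Lemma mdirs_single (T : Type) (e : 'I_n -> T) j k : mdirs e (single j k) = nseq k (e j).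
Proof.
rewrite /mdirs.
have H (s : seq 'I_n) : uniq s ->
    flatten [seq nseq (single j k i) (e i) | i <- s] = if j \in s then nseq k (e j) else [::].
  elim: s => //= i s IH /andP[iNs us]; rewrite IH// ffunE inE eq_sym.
  case: eqP => [ji|_] //=; rewrite -ji in iNs *.
  by rewrite (negbTE iNs) cats0.
by rewrite H ?enum_uniq// mem_enum.
Qed.

Lemma mderive_single j k u : mderive (single j k) u = iderive (nseq k (basis_rV R j)) u.
Proof. by rewrite /mderive mdirs_single. Qed.

Lemma mmonomial0 x : mmonomial (0%R : {ffun 'I_n -> nat}) x = 1.
Proof. by rewrite /mmonomial big1// => i _; rewrite ffunE expr0. Qed.

Lemma mabs0 : mabs (0 : {ffun 'I_n -> nat}) = 0%N.
Proof. by rewrite /mabs big1// => i _; rewrite ffunE. Qed.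

Lemma mderive0 u : mderive (0 : {ffun 'I_n -> nat}) u = u.
Proof.
rewrite /mderive /mdirs (_ : flatten _ = [::])//.
by elim: (enum _) => //= i s ->; rewrite ffunE.
Qed.

Lemma csmooth_measurable u s : csmooth u -> cmeasurable (iderive s u).
Proof.
move=> su; split; apply: continuous_measurable_rV => x;
  apply: differentiable_continuous; by have [] := su s x.
Qed.

(** The seminorms with x^alpha a power of one coordinate are enough, by
    le_wtV. *)
Lemma schwartz_rapid phi (beta : multi_index n) : schwartz phi -> rapid (mderive beta phi).
Proof.
move=> [sphi bphi]; split; first exact: csmooth_measurable.
move=> k; apply: le_wtV => [x||j]; first exact: normc_ge0.
  have [C HC] := bphi 0 beta; exists C => x.
  by have := HC x; rewrite mmonomial0 mul1r.
have [C HC] := bphi (single j k) beta; exists C => x.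
by have := HC x; rewrite mmonomial_single Normc.normcM normc_real normrX mulrC.
Qed.

Lemma schwartz_rapid0 phi : schwartz phi -> rapid phi.
Proof. by move=> sphi; have := schwartz_rapid 0 sphi; rewrite mderive0. Qed.

Lemma schwartz_chain phi j : schwartz phi ->
  derivative_chain (basis_rV R j) (fun k => mderive (single j k) phi).
Proof.
move=> sphi; split => [k|k x]; first exact: rapid_dominated (schwartz_rapid _ sphi).
rewrite !mderive_single; have [dr di] := sphi.1 (nseq k (basis_rV R j)) x.
by split; apply: DeriveDef => //; exact: diff_derivable.
Qed.

Lemma fourier_le phi C xi : dominated phi C -> normc (fourier phi xi) <= 2 * C * wtmass R n.
Proof. by move=> dphi; apply: normc_cintegral; exact: dominated_fourier. Qed.

(** The oscillating factors at xi and eta differ by O(|x| |xi - eta|). The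
    Lipschitz bound makes the transform measurable, and later controls F (t (w
    + xi)) - F 0. *)
Lemma fourier_lipschitz phi : rapid phi ->
  exists L : R, 0 <= L /\
    forall xi eta, normc (fourier phi xi - fourier phi eta) <= L * `|xi - eta|.
Proof.
move=> rphi; have [C [C0 phiC]] := rapid_wt 1 rphi.
have [D dphi] := rapid_dominated rphi.
exists (2 * (4 * pi * n%:R * C) * wtmass R n); split.
  by rewrite !mulr_ge0// ?pi_ge0// wtmass_ge0.
move=> xi eta; rewrite /fourier.
rewrite -(cintegralB (dominated_fourier xi dphi) (dominated_fourier eta dphi)).
rewrite (_ : _ * `|_| = 2 * (4 * pi * n%:R * C * `|xi - eta|) * wtmass R n); last by ring.
apply: normc_cintegral; split.
  have [m1 _] := dominated_fourier xi dphi; have [m2 _] := dominated_fourier eta dphi.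
  exact: cmeasurableB.
move=> x; rewrite -mulrBl Normc.normcM.
have -> : expi (- (2 * pi * dotp x xi)) - expi (- (2 * pi * dotp x eta)) =
    expi (- (2 * pi * dotp x eta)) * (expi (- (2 * pi * dotp x (xi - eta))) - 1).
  by rewrite mulrBr mulr1 -expiD dotpDr dotpNr; congr (expi _ - _); ring.
rewrite Normc.normcM normc_expi mul1r.
have e1 := normc_expiB1 (- (2 * pi * dotp x (xi - eta))).
rewrite normrN !normrM (ger0_norm (pi_ge0 R)) (ger0_norm (ler0n R 2)) in e1.
apply: (@le_trans _ _ ((4 * pi * n%:R * `|xi - eta| * wt x) * normc (phi x))).
  rewrite ler_wpM2r ?normc_ge0// (le_trans e1)//.
  have p0 := pi_ge0 R.
  rewrite (@le_trans _ _ (2 * (2 * pi * (n%:R * `|x| * `|xi - eta|))))//.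
    by rewrite ler_wpM2l// ler_wpM2l ?mulr_ge0// le_dotp.
  rewrite (_ : 2 * _ = 4 * pi * n%:R * `|xi - eta| * `|x|); last by ring.
  by rewrite ler_wpM2l ?mulr_ge0// /wt lerDr.
have := phiC x; rewrite expr1 => px.
rewrite (_ : _ * normc (phi x) =
  4 * pi * n%:R * `|xi - eta| * (normc (phi x) * wt x)); last by ring.
rewrite (_ : _ * wt x ^- n.*2 =
  4 * pi * n%:R * `|xi - eta| * (C * wt x ^- n.*2)); last by ring.
by rewrite ler_wpM2l// !mulr_ge0// pi_ge0.
Qed.

Lemma lipschitz_measurable u (L : R) :
  (forall x y, normc (u x - u y) <= L * `|x - y|) -> cmeasurable u.
Proof.
move=> uL.
have key (f : V -> R) : (forall x y, `|f x - f y| <= L * `|x - y|) -> measurable_fun setT f.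
  move=> fL.
  have L0 : 0 < `|L| + 1 by rewrite ltr_wpDl.
  have cf (x : V) : f y @[y --> x] --> f x.
    apply/(@cvgrPdist_le R R^o V (nbhs x) (nbhs_filter x)) => e e0; apply/nbhs_ballP.
    exists ((`|L| + 1)^-1 * e) => [|y]; first by rewrite /= mulr_gt0// invr_gt0.
    rewrite -ball_normE/= => /ltW xy.
    rewrite (le_trans (fL x y))// (@le_trans _ _ ((`|L| + 1) * `|x - y|))//.
      by rewrite ler_wpM2r// (le_trans (ler_norm L))// lerDl.
    by rewrite -ler_pdivlMl.
  exact: continuous_measurable_rV cf.
split; apply: key => x y; rewrite -?ReB -?ImB (le_trans _ (uL x y))//.
  exact: le_Re_normc.
exact: le_Im_normc.
Qed.

(** Where |xi_j| > 1/2, fourier_chain_decay applies with h = 1 / (2 xi_j) and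
    gives a bound by a multiple of |xi_j|^(-k). *)
Lemma fourier_rapid phi : schwartz phi -> rapid (fourier phi).
Proof.
move=> sphi; have rphi := schwartz_rapid0 sphi; have [D dphi] := rapid_dominated rphi.
split.
  by have [L [_ HL]] := fourier_lipschitz rphi; exact: lipschitz_measurable HL.
move=> k; apply: le_wtV => [x||j]; first exact: normc_ge0.
  by exists (2 * D * wtmass R n) => xi; exact: fourier_le.
have cphi := schwartz_chain j sphi.
have [A dA] := cphi.1 k.
have [A0 D0 W0] := And3 (dominated_ge0 dA) (dominated_ge0 dphi) (wtmass_ge0 R n).
have phiE : fourier phi = fourier (mderive (single j 0) phi).
  by rewrite mderive_single.
exists (2 * D * wtmass R n + (2 ^+ n.*2) ^+ k * (2 * A * wtmass R n)) => xi.
have [xi1|xi1] := leP `|xi ord0 j| (2^-1).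
  rewrite (@le_trans _ _ (2 * D * wtmass R n * 1))//.
    rewrite ler_pM ?normc_ge0 ?exprn_ge0 ?fourier_le//.
    by rewrite exprn_ile1// (le_trans xi1)// invf_le1// ler1n.
  by rewrite mulr1 lerDl !mulr_ge0// exprn_ge0// exprn_ge0.
have xi0 : xi ord0 j != 0 by rewrite -normr_gt0 (lt_trans _ xi1)// invr_gt0.
pose h := (2 * xi ord0 j)^-1.
have hE : `|h| = 2^-1 / `|xi ord0 j| by rewrite /h normfV normrM ger0_norm// invfM.
have h1 : `|h| <= 1.
  by rewrite hE ler_pdivrMr ?normr_gt0// mul1r ltW.
have hxi : expi (2 * pi * dotp (h *: basis_rV R j) xi) = -1.
  rewrite dotpZl dotp_basis -expipi; congr expi.
  by rewrite /h; field.
have := fourier_chain_decay cphi (norm_basis R j) h1 hxi dA.2.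
rewrite -phiE => Fxi.
rewrite (@le_trans _ _ ((2 ^+ n.*2) ^+ k * (2 * A * wtmass R n)))//; last first.
  by rewrite lerDr !mulr_ge0.
have -> : (2 ^+ n.*2) ^+ k * (2 * A * wtmass R n) =
    (2 * 2 ^+ n.*2 * `|h|) ^+ k * (2 * A * wtmass R n) * `|xi ord0 j| ^+ k.
  rewrite [RHS]mulrAC -exprMn; congr (_ ^+ _ * _).
  by rewrite hE; field; rewrite normr_eq0.
by rewrite ler_wpM2r// exprn_ge0.
Qed.

End schwartz_rapid.

(** * Two estimates of the Morrey norm *)

(** The integral of a nonnegative function is a supremum over the simple
    functions below it, so monotonicity extends to functions that may fail to
    be measurable, such as the maximal function, a supremum of uncountably many
    functions. *)
Lemma le_integral_ge0 d (T : measurableType d) (R : realType)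
    (mu : {measure set T -> \bar R}) (D : set T) (f g : T -> \bar R) :
  (forall x, D x -> 0 <= f x)%E -> (forall x, D x -> f x <= g x)%E ->
  (\int[mu]_(x in D) f x <= \int[mu]_(x in D) g x)%E.
Proof.
move=> f0 fg.
have g0 x : D x -> (0 <= g x)%E by move=> Dx; exact: le_trans (f0 x Dx) (fg x Dx).
rewrite (ge0_integralE _ f0) (ge0_integralE _ g0); apply: ereal_sup_le => _ /= [h hf <-].
exists h => // x; rewrite (le_trans (hf x))// /patch.
by case: ifPn => // /set_mem; exact: fg.
Qed.

Section morrey.
Variables (R : realType) (n : nat).
Local Notation mu := (lebesgue_rV R n).
Local Notation V := 'rV[R]_n.
Variables (q lam : R).
Hypotheses (q0 : 0 < q) (qlam : q < lam).

Let lam0 : 0 < lam. Proof. exact: lt_trans q0 qlam. Qed.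

Lemma cubeE (c : V) l : cube c l = box (fun i => `[c ord0 i, c ord0 i + l]%classic).
Proof. by apply/seteqP; split => x /= xc i; have := xc i; rewrite /= in_itv. Qed.

Lemma measurable_cube (c : V) l : measurable (cube c l).
Proof. by rewrite cubeE; apply: measurable_box. Qed.

Lemma lebesgue_cube (c : V) l : 0 < l -> mu (cube c l) = (l ^+ n)%:E.
Proof.
move=> l0; rewrite cubeE lebesgue_box//.
under eq_bigr do rewrite lebesgue_measure_itv/= lte_fin ltrDl l0 -EFinB addrAC subrr add0r.
by rewrite prodEFin prodr_const card_ord.
Qed.

Lemma powR_cube_cancel (a A : R) : 0 < a -> 0 <= A ->
  a `^ (lam^-1 - q^-1) * (A `^ q * a) `^ q^-1 = a `^ lam^-1 * A.
Proof.
move=> a0 A0; rewrite powRM ?powR_ge0// ?(ltW a0)// -powRrM divff ?gt_eqF// powRr1//.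
rewrite mulrCA mulrC -powRD ?subrK//.
by apply/implyP => _; rewrite gt_eqF.
Qed.

(** Testing the supremum on a single cube. *)
Lemma morrey_norm_ge (g : V -> \bar R) (c : V) (l A : R) : 0 < l -> 0 <= A ->
  (forall y, cube c l y -> A%:E <= `|g y|)%E ->
  (((l ^+ n) `^ lam^-1 * A)%:E <= morrey_norm q lam g)%E.
Proof.
move=> l0 A0 gA; have ln0 : 0 < l ^+ n by exact: exprn_gt0.
apply: le_ereal_sup_tmp.
exists (mu (cube c l) `^ (lam^-1 - q^-1) *
   (\int[mu]_(y in cube c l) (`|g y| `^ q)) `^ q^-1)%E.
  by exists (cube c l) => //; exists c, l.
rewrite lebesgue_cube// poweR_EFin -(powR_cube_cancel ln0 A0) EFinM.
rewrite lee_wpmul2l ?lee_fin ?powR_ge0//.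
rewrite -poweR_EFin; apply: gt0_ler_poweR; rewrite ?invr_ge0 ?(ltW q0)//.
- by rewrite in_itv/= leey andbT lee_fin mulr_ge0 ?powR_ge0// ltW.
- by rewrite in_itv/= leey andbT; apply: integral_ge0 => y _; exact: poweR_ge0.
rewrite EFinM -(lebesgue_cube c l0) -(integral_cst mu (measurable_cube c l)).
apply: le_integral_ge0 => y cy; first by rewrite lee_fin powR_ge0.
rewrite /= -poweR_EFin; apply: gt0_ler_poweR;
  rewrite ?(ltW q0)// ?in_itv/= ?leey ?andbT ?lee_fin//.
exact: gA.
Qed.

(** On a cube Q of side at least 1 the power of |Q| is at most 1, its exponent
    being negative, and the integral of |g|^q converges because k q >= 2 n. On
    a smaller cube |g| <= C, and the powers of |Q| combine to |Q|^(1 / lam),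
    which is at most 1. *)
Lemma morrey_norm_le (C : R) (k : nat) : 0 <= C -> n.*2%:R <= k%:R * q ->
  exists M : R, 0 <= M /\ forall g : V -> \bar R,
    (forall y, `|g y| <= (C * wt y ^- k)%:E)%E -> (morrey_norm q lam g <= M%:E)%E.
Proof.
move=> C0 kq; set W := wtmass R n.
exists ((C `^ q * W) `^ q^-1 + C); split; first by rewrite addr_ge0// powR_ge0.
move=> g gC; apply: ge_ereal_sup => _ /= [_ [c [l l0 ->]] <-].
have ln0 : 0 < l ^+ n by exact: exprn_gt0.
have lamq : lam^-1 - q^-1 <= 0 by rewrite subr_le0 lef_pV2 ?posrE// ltW.
rewrite lebesgue_cube// poweR_EFin.
have gq y : (`|g y| `^ q <= (C `^ q * wt y ^- n.*2)%:E)%E.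
  rewrite (@le_trans _ _ (((C * wt y ^- k) `^ q)%:E))//.
    rewrite -poweR_EFin; apply: gt0_ler_poweR;
      rewrite ?(ltW q0)// ?in_itv/= ?leey ?andbT ?abse_ge0//.
    by rewrite lee_fin mulr_ge0// wtV_ge0.
  rewrite lee_fin powRM ?wtV_ge0// ler_wpM2l ?powR_ge0//.
  rewrite -(powR_invn _ (wt_ge0 y)) -powRrM -(powR_invn _ (wt_ge0 y)).
  by apply: ler_powR; [exact: wt_ge1|rewrite mulNr lerN2].
have I0 : (0 <= \int[mu]_(y in cube c l) (`|g y| `^ q))%E.
  by apply: integral_ge0 => y _; exact: poweR_ge0.
have [l1|l1] := leP 1 l.
  have I1 : (\int[mu]_(y in cube c l) (`|g y| `^ q) <= (C `^ q * W)%:E)%E.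
    rewrite (@le_trans _ _ (\int[mu]_(y in cube c l) (C `^ q * wt y ^- n.*2)%:E)%E)//.
      by apply: le_integral_ge0 => y _; [exact: poweR_ge0|exact: gq].
    have mw : measurable_fun setT (fun y : V => (wt y ^- n.*2)%:E).
      by apply/measurable_EFinP; exact: measurable_wtV.
    rewrite EFinM -integral_wtE -ge0_integralZl//; first last.
    - by rewrite lee_fin powR_ge0.
    - by move=> y _; rewrite lee_fin wtV_ge0.
    apply: ge0_subset_integral => //; first exact: measurable_cube.
    - by apply/measurable_EFinP; apply: measurable_funM => //; exact: measurable_wtV.
    - by move=> y _; rewrite lee_fin mulr_ge0 ?powR_ge0// wtV_ge0.
  rewrite (@le_trans _ _ (1%:E * ((C `^ q * W) `^ q^-1)%:E)%E)//; last first.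
    by rewrite mul1e lee_fin lerDl.
  apply: lee_pmul; rewrite ?lee_fin ?powR_ge0 ?poweR_ge0//.
    by rewrite -(powRr0 (l ^+ n)); apply: ler_powR => //; rewrite exprn_ege1.
  rewrite -poweR_EFin; apply: gt0_ler_poweR; rewrite ?invr_ge0 ?(ltW q0)//.
  - by rewrite in_itv/= leey andbT.
  - by rewrite in_itv/= leey andbT lee_fin mulr_ge0 ?powR_ge0// wtmass_ge0.
have I1 : (\int[mu]_(y in cube c l) (`|g y| `^ q) <= (C `^ q * l ^+ n)%:E)%E.
  rewrite EFinM -(lebesgue_cube c l0) -(integral_cst mu (measurable_cube c l)).
  apply: le_integral_ge0 => y _; first exact: poweR_ge0.
  rewrite (le_trans (gq y))// lee_fin ler_piMr ?powR_ge0// invf_le1 ?exprn_ege1 ?wt_ge1//.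
  by rewrite exprn_gt0// wt_gt0.
rewrite (@le_trans _ _ ((l ^+ n) `^ (lam^-1 - q^-1) * (C `^ q * l ^+ n) `^ q^-1)%:E)//.
  rewrite EFinM lee_wpmul2l ?lee_fin ?powR_ge0//.
  rewrite -poweR_EFin; apply: gt0_ler_poweR; rewrite ?invr_ge0 ?(ltW q0)//.
  - by rewrite in_itv/= leey andbT.
  - by rewrite in_itv/= leey andbT lee_fin mulr_ge0 ?powR_ge0// ltW.
rewrite powR_cube_cancel// lee_fin (@le_trans _ _ C)//; last by rewrite lerDr powR_ge0.
rewrite ler_piMl// -[leRHS]/((fun=> 1) lam^-1) -powR1.
apply: ge0_ler_powR; rewrite ?invr_ge0 ?nnegrE ?(ltW lam0) ?(ltW ln0)//.
by rewrite exprn_ile1// ?(ltW l0)// ltW.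
Qed.

End morrey.

(** * Modulated bumps *)

Section modulated.
Variables (R : realType) (n : nat).
Local Notation V := 'rV[R]_n.
Implicit Types (phi u v : V -> R[i]) (x w : V) (t : R).

(** The bump phi with its spectrum translated by w. *)
Definition modulated phi w : functional R n := fun v =>
  cintegral (fun y => expi (2 * pi * dotp y w) * phi y * v y).

Lemma measurable_pdotp w : measurable_fun setT (fun x : V => 2 * pi * dotp x w).
Proof. by apply: measurable_funM => //; exact: measurable_dotpl. Qed.

Lemma dominated_modulated phi w v D E : dominated phi D -> cmeasurable v ->
  (forall y, normc (v y) <= E) ->
  dominated (fun y => expi (2 * pi * dotp y w) * phi y * v y) (E * D).
Proof.
move=> dphi mv vE.
have := dominatedM (dominated_expi (measurable_pdotp w) dphi) mv vE.
by under [X in dominated X]eq_fun do rewrite mulrC.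
Qed.

Lemma rapid_bounded u : rapid u -> exists E, forall y, normc (u y) <= E.
Proof.
by move=> [_ /(_ 0%N)[E uE]]; exists E => y; have := uE y; rewrite expr0 invr1 mulr1.
Qed.

Lemma modulated_tempered phi w : schwartz phi -> tempered (modulated phi w).
Proof.
move=> sphi; have [D dphi] := rapid_dominated (schwartz_rapid0 sphi).
have D0 := dominated_ge0 dphi; have W0 := wtmass_ge0 R n.
split=> [z u v su sv|e e0].
  have ru := schwartz_rapid0 su; have rv := schwartz_rapid0 sv.
  have [Eu uE] := rapid_bounded ru; have [Ev vE] := rapid_bounded rv.
  have du := dominated_modulated w dphi ru.1 uE.
  have dv := dominated_modulated w dphi rv.1 vE.
  rewrite /modulated -(cintegralZ z du) -(cintegralD (dominatedZ z du) dv).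
  by congr cintegral; apply/funext => y; rewrite mulrDr mulrCA.
exists 0%N; exists (e / (2 * D * wtmass R n + 1)).
  by rewrite divr_gt0// ltr_wpDl// !mulr_ge0.
move=> u su ub; have ru := schwartz_rapid0 su.
have uE y : normc (u y) <= e / (2 * D * wtmass R n + 1).
  have := ub 0 0; rewrite mabs0 => /(_ (leqnn _) (leqnn _) y).
  by rewrite mmonomial0 mul1r mderive0.
have du := dominated_modulated w dphi ru.1 uE.
rewrite (le_trans (normc_cintegral du))//.
rewrite (_ : 2 * _ * _ = e * (2 * D * wtmass R n / (2 * D * wtmass R n + 1))); last by ring.
rewrite ler_piMr ?(ltW e0)// ler_pdivrMr ?mul1r ?lerDl//.
by rewrite ltr_wpDl// !mulr_ge0.
Qed.

Lemma cmeasurable_dilate phi t x : cmeasurable phi ->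
  cmeasurable (fun y : V => dilate phi t (x - y)).
Proof.
move=> mphi; apply: cmeasurableM; first exact: cmeasurable_cst.
have := cmeasurable_comp mphi (@measurable_affine R n (t^-1 *: x) (- t^-1)).
rewrite (_ : (fun _ => _) = (fun y => phi (t^-1 *: (x - y))))//.
by apply/funext => y; rewrite /affine scalerBr scaleNr.
Qed.

(** After the substitution y = x - t z the integrand has modulus |phi (x - t
    z)| |phi z|, in which w has disappeared. As t <= 1, replacing x - t z by x
    in the decay of the first factor costs a power of 1 + |z|, which the
    second one pays. *)
Lemma convolution_modulated_le phi k : schwartz phi ->
  exists C : R, 0 <= C /\ forall w t x, 0 < t <= 1 ->
    normc (convolution (dilate phi t) (modulated phi w) x) <= C * wt x ^- k.
Proof.
move=> sphi; have rphi := schwartz_rapid0 sphi.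
have [D dphi] := rapid_dominated rphi.
have [B phiB] := rapid_bounded rphi.
have [C phiC] := rphi.2 k.
have [E [E0 phiE]] := rapid_wt k rphi.
have C0 : 0 <= C.
  have := le_trans (normc_ge0 _) (phiC 0).
  by rewrite /wt normr0 addr0 expr1n invr1 mulr1.
have W0 := wtmass_ge0 R n.
exists (2 * (C * E) * wtmass R n); split; first by rewrite !mulr_ge0.
move=> w t x /andP[t0 t1]; rewrite /convolution /modulated.
have tn0 : t != 0 by rewrite gt_eqF.
have mphi := cmeasurable_dilate t x rphi.1.
have phitB y : normc (dilate phi t (x - y)) <= normc (t ^- n)%:C * B.
  by rewrite Normc.normcM ler_wpM2l// normc_ge0.
have du := dominated_modulated w dphi mphi phitB.
rewrite (cintegral_affine x (_ : - t != 0) du) ?oppr_eq0// normrN gtr0_norm//.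
have dg : dominated (fun z => (t ^+ n)%:C * (expi (2 * pi * dotp (affine x (- t) z) w) *
    phi (affine x (- t) z) * dilate phi t (x - affine x (- t) z))) (C * E * wt x ^- k).
  have dE z : (t ^+ n)%:C * (expi (2 * pi * dotp (affine x (- t) z) w) *
    phi (affine x (- t) z) * dilate phi t (x - affine x (- t) z)) =
    expi (2 * pi * dotp (affine x (- t) z) w) * phi (affine x (- t) z) * phi z.
    rewrite /dilate /affine opprD addrA subrr add0r scaleNr opprK scalerA mulVf// scale1r.
    rewrite mulrCA; congr (_ * _); rewrite mulrA -rmorphM/= divff ?rmorph1 ?mul1r//.
    by rewrite expf_neq0.
  rewrite (funext dE); split.
    apply: cmeasurableM; last exact: rphi.1.
    apply: cmeasurableM.
      apply: cmeasurable_expi; apply: measurable_funM => //.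
      exact: (measurableT_comp (measurable_dotpl w) (measurable_affine _ _)).
    exact: (cmeasurable_comp rphi.1 (measurable_affine _ _)).
  move=> z; rewrite !Normc.normcM normc_expi mul1r.
  rewrite (@le_trans _ _ (C * (wt z ^+ k * wt x ^- k) * normc (phi z)))//; last first.
    rewrite (_ : C * _ * _ = C * wt x ^- k * (normc (phi z) * wt z ^+ k)); last by ring.
    rewrite (_ : C * _ * _ * _ = C * wt x ^- k * (E * wt z ^- n.*2)); last by ring.
    by rewrite ler_wpM2l ?mulr_ge0 ?wtV_ge0.
  rewrite ler_wpM2r ?normc_ge0// (le_trans (phiC _))// ler_wpM2l// /affine addrC.
  rewrite (le_trans (wt_shift _ _ _))// ler_wpM2r ?wtV_ge0// lerXn2r ?nnegrE ?wt_ge0//.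
  by rewrite /wt lerD2l normrZ normrN gtr0_norm// ler_piMl.
have [B' phiB'] : exists B', dominated (fun z => expi (2 * pi * dotp (affine x (- t) z) w) *
    phi (affine x (- t) z) * dilate phi t (x - affine x (- t) z)) B'.
  exists ((normc ((t ^+ n)%:C)^-1) * (C * E * wt x ^- k)).
  have := dominatedZ ((t ^+ n)%:C)^-1 dg.
  under [X in dominated X]eq_fun do
    rewrite mulKf ?eq_complex/= ?expf_eq0 ?(negbTE tn0) ?andbF//.
  by [].
rewrite -(cintegralZ _ phiB') (le_trans (normc_cintegral dg))//.
by rewrite (_ : 2 * _ * _ = 2 * (C * E) * wtmass R n * wt x ^- k)//; ring.
Qed.

Lemma modulated_hM_le phi q lam : schwartz phi -> 0 < q -> q < lam ->
  exists M : R, forall w, (hM_norm phi q lam (modulated phi w) <= M%:E)%E.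
Proof.
move=> sphi q0 qlam.
pose k := (Num.truncn (n.*2%:R / q)).+1.
have kq : n.*2%:R <= k%:R * q by rewrite -ler_pdivrMr// ltW// truncnS_gt.
have [C [C0 HC]] := convolution_modulated_le k sphi.
have [M [_ HM]] := morrey_norm_le q0 qlam C0 kq.
exists M => w; apply: HM => y.
rewrite gee0_abs; last first.
  apply: le_ereal_sup_tmp; exists (normc (convolution (dilate phi 1) (modulated phi w) y))%:E.
    by exists 1 => //=; rewrite ltr01 lexx.
  by rewrite lee_fin normc_ge0.
by apply: ge_ereal_sup => _ /= [t t01 <-]; rewrite lee_fin; exact: HC.
Qed.

End modulated.

(** * The Bessel operator on modulated bumps *)

Section bessel_formula.
Variables (R : realType) (n : nat) (m : R).
Hypothesis m0 : 0 < m.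
Local Notation V := 'rV[R]_n.
Implicit Types (phi u v : V -> R[i]) (x w xi : V) (t : R).

Definition bessel xi : R := (1 + dotp xi xi) `^ (m / 2).

Lemma bessel_ge0 xi : 0 <= bessel xi. Proof. exact: powR_ge0. Qed.

Lemma oneDdotp_gt0 xi : 0 < 1 + dotp xi xi :> R.
Proof. by rewrite ltr_wpDr ?dotpp_ge0. Qed.

Lemma bessel_gt0 xi : 0 < bessel xi.
Proof. exact/powR_gt0/oneDdotp_gt0. Qed.

Lemma measurable_bessel : measurable_fun setT bessel.
Proof.
have ms : measurable_fun setT (fun x : V => 1 + dotp x x).
  apply: measurable_funD => //; apply: measurable_sum => i.
  by apply: measurable_funM; exact: measurable_coor.
rewrite /bessel; exact: (measurableT_comp (@measurable_powR R (m / 2)) ms).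
Qed.

(** An integer above m / 2, so that polynomials control the symbol. *)
Definition bdeg : nat := (Num.truncn m).+1.

Lemma bdeg_ge : m / 2 <= bdeg%:R.
Proof.
rewrite (@le_trans _ _ m)//; last exact/ltW/truncnS_gt.
by rewrite ler_pdivrMr// ler_peMr ?(ltW m0)// ler1n.
Qed.

Lemma bessel_le xi : bessel xi <= n.+1%:R ^+ bdeg * wt xi ^+ bdeg.*2.
Proof.
have s1 : 1 <= 1 + dotp xi xi by rewrite lerDl dotpp_ge0.
rewrite (@le_trans _ _ ((1 + dotp xi xi) `^ bdeg%:R))//.
  by apply: ler_powR => //; exact: bdeg_ge.
rewrite powR_mulrn; last exact: le_trans ler01 s1.
rewrite -mul2n exprM -exprMn.
rewrite lerXn2r ?nnegrE ?mulr_ge0 ?exprn_ge0 ?wt_ge0 ?(le_trans ler01 s1)//.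
have := le_dotp xi xi; rewrite ger0_norm ?dotpp_ge0// => d.
rewrite (@le_trans _ _ (1 + n%:R * `|xi| * `|xi|))// ?lerD2l//.
have x0 := normr_ge0 xi; have nn0 := ler0n R n.
rewrite /wt -natr1 -subr_ge0.
rewrite (_ : _ - _ = `|xi| * `|xi| + 2 * `|xi| + n%:R * (1 + 2 * `|xi|)); last by ring.
by rewrite !addr_ge0 ?mulr_ge0 ?addr_ge0 ?mulr_ge0.
Qed.

Variables (phi : V -> R[i]).
Hypothesis sphi : schwartz phi.

Let rphi : rapid phi. Proof. exact: schwartz_rapid0. Qed.
Let rF : rapid (fourier phi). Proof. exact: fourier_rapid. Qed.

(** The value at x of the convolution of phi_t with J_m f is f applied to the
    Fourier transform of this function of xi. *)
Definition bessel_kernel t x xi : R[i] :=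
  (bessel xi)%:C * expi (2 * pi * dotp x xi) * fourier phi (t *: xi).

Lemma dominated_bessel_kernel t x : t != 0 -> exists C, dominated (bessel_kernel t x) C.
Proof.
move=> t0; have rFt := rapid_affine 0 t0 rF.
have [E [E0 FE]] := rapid_wt bdeg.*2 rFt.
exists (n.+1%:R ^+ bdeg * E); rewrite /bessel_kernel.
have FtE xi : fourier phi (affine 0 t xi) = fourier phi (t *: xi) by rewrite /affine add0r.
split.
  apply: cmeasurableM; last by have := rFt.1; under [X in cmeasurable X]eq_fun do rewrite FtE.
  apply: cmeasurableM; first by apply: cmeasurable_real; exact: measurable_bessel.
  apply: cmeasurable_expi; apply: measurable_funM => //.
  by have := @measurable_dotpl R n x; under eq_fun do rewrite dotpC.
move=> xi; rewrite !Normc.normcM normc_expi mulr1 normc_real ger0_norm ?bessel_ge0//.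
apply: (@le_trans _ _ (n.+1%:R ^+ bdeg * (normc (fourier phi (t *: xi)) * wt xi ^+ bdeg.*2))).
  by rewrite [X in _ <= _ * X]mulrC mulrA ler_wpM2r ?normc_ge0// bessel_le.
by rewrite -mulrA ler_wpM2l ?exprn_ge0// -FtE.
Qed.

(** Substitution y = x - t z. *)
Lemma bessel_transform t x xi : 0 < t ->
  cintegral (fun y => expi (2 * pi * dotp y xi) * bessel_symbol m (y, xi) *
                      dilate phi t (x - y)) = bessel_kernel t x xi.
Proof.
move=> t0; have tn0 : t != 0 by rewrite gt_eqF.
have [D dphi] := rapid_dominated rphi.
have tC : (t ^+ n)%:C != 0 :> R[i] by rewrite eq_complex /= expf_eq0 (negbTE tn0) andbF.
pose u y := expi (2 * pi * dotp y xi) * bessel_symbol m (y, xi) * dilate phi t (x - y).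
have uE z : u (affine x (- t) z) =
    ((t ^+ n)%:C)^-1 * ((bessel xi)%:C * expi (2 * pi * dotp x xi) *
    (expi (- (2 * pi * dotp z (t *: xi))) * phi z)).
  rewrite /u /dilate /affine opprD addrA subrr add0r scaleNr opprK scalerA mulVf// scale1r.
  rewrite /bessel_symbol/= -/(bessel xi).
  rewrite (_ : expi (2 * pi * dotp (x - t *: z) xi) =
     expi (2 * pi * dotp x xi) * expi (- (2 * pi * dotp z (t *: xi)))); last first.
    by rewrite -expiD dotpDl dotpNl dotpZl dotpZr; congr expi; ring.
  rewrite (_ : (t ^- n)%:C = ((t ^+ n)%:C)^-1); last by rewrite -rmorphV//= unitfE expf_neq0.
  by ring.
have [B du] : exists B, dominated u B.
  have tV0 : - t^-1 != 0 by rewrite oppr_eq0 invr_eq0.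
  have dd := dominated_affine (t^-1 *: x) tV0 dphi.
  have d2 := dominatedZ ((bessel xi)%:C * (t ^- n)%:C)
    (dominated_expi (measurable_pdotp xi) dd).
  eexists; apply: (eq_ind _ (fun g => dominated g _) d2); apply/funext => y.
  rewrite /u /dilate /affine scaleNr -scalerBr /bessel_symbol/= -/(bessel xi); ring.
rewrite -[LHS]/(cintegral u) (cintegral_affine x (_ : - t != 0) du) ?oppr_eq0//.
rewrite normrN gtr0_norm//.
rewrite (funext uE) (cintegralZ _ (dominatedZ _ (dominated_fourier (t *: xi) dphi))) mulVKf//.
by rewrite (cintegralZ _ (dominated_fourier (t *: xi) dphi)).
Qed.

(** Fubini moves the operator from the test function to the bump, whose
    transform is F (xi - w); a translation of xi then recentres it at 0. *)
Lemma convolution_bessel t x w : 0 < t ->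
  convolution (dilate phi t) (Jop n m (modulated phi w)) x =
  cintegral (fun xi => bessel_kernel t x (w + xi) * fourier phi xi).
Proof.
move=> t0; have tn0 : t != 0 by rewrite gt_eqF.
have [D dphi] := rapid_dominated rphi; have [B dG] := dominated_bessel_kernel x tn0.
have [E FE] := rapid_bounded rF.
rewrite /convolution /Jop /pseudodiff.
rewrite (_ : (fun xi : V => cintegral _) = bessel_kernel t x); last first.
  by apply/funext => xi; exact: bessel_transform.
set G := bessel_kernel t x.
pose K (y xi : V) := expi (2 * pi * dotp y w) * phi y * (expi (- (2 * pi * dotp xi y)) * G xi).
have KE y : expi (2 * pi * dotp y w) * phi y * fourier G y = cintegral (K y).
  by rewrite (cintegralZ _ (dominated_fourier y dG)).
rewrite /modulated (funext KE) (@cintegral_swap _ _ K (D * B)); first last.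
- move=> y xi; rewrite /K Normc.normcM [X in X * _]Normc.normcM.
  rewrite [X in _ * X]Normc.normcM !normc_expi !mul1r.
  rewrite (_ : D * B * _ * _ = (D * wt y ^- n.*2) * (B * wt xi ^- n.*2)); last by ring.
  by rewrite ler_pM ?normc_ge0//; [exact: dphi.2|exact: dG.2].
- have md := @measurable_dotp R n.
  apply: cmeasurableM; apply: cmeasurableM.
  + apply: cmeasurable_expi; apply: measurable_funM => //.
    exact: (measurableT_comp (measurable_dotpl w) measurable_fst).
  + exact: (cmeasurable_comp rphi.1 measurable_fst).
  + apply: cmeasurable_expi; apply: measurable_funN; apply: measurable_funM => //.
    by under eq_fun do rewrite dotpC.
  + exact: (cmeasurable_comp dG.1 measurable_snd).
have KE2 xi : cintegral (K ^~ xi) = G xi * fourier phi (- w + xi).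
  rewrite -(cintegralZ _ (dominated_fourier _ dphi)); congr cintegral; apply/funext => y.
  rewrite /K (_ : expi (- (2 * pi * dotp y (- w + xi))) =
    expi (2 * pi * dotp y w) * expi (- (2 * pi * dotp xi y))); last first.
    by rewrite -expiD dotpDr dotpNr (dotpC xi); congr expi; ring.
  by ring.
rewrite (funext KE2).
have dGF : exists B', dominated (fun xi => G xi * fourier phi (- w + xi)) B'.
  have mF : cmeasurable (fun xi => fourier phi (- w + xi)).
    have := (rapid_affine (- w) (oner_neq0 R) rF).1.
    by rewrite /affine; under [X in cmeasurable X]eq_fun do rewrite scale1r.
  have := dominatedM dG mF (fun xi => FE _).
  by under [X in dominated X]eq_fun do rewrite mulrC; eexists; eassumption.
have [B' dGF'] := dGF.
rewrite (cintegral_affine w (oner_neq0 R) dGF') normr1 expr1n mul1r; congr cintegral.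
by apply/funext => xi; rewrite /affine scale1r addKr.
Qed.

End bessel_formula.

(** * Nonvanishing of the inverse Fourier integral *)

(** On both sides of 1, the power rho^k with the larger integer exponent is
    farther from 1 than rho^p, and rho^k - 1 is divisible by rho - 1. *)
Lemma powR_sub1_le (R : realType) (p rho M : R) (k : nat) :
  0 <= p -> p <= k%:R -> 0 < rho -> rho <= M -> 1 <= M ->
  `|rho `^ p - 1| <= k%:R * M ^+ k * `|rho - 1|.
Proof.
move=> p0 pk rho0 rhoM M1.
apply: (@le_trans _ _ `|rho ^+ k - 1|).
  have [r1|r1] := leP 1 rho.
    have a1 : 1 <= rho `^ p by rewrite -(powRr0 rho); exact: ler_powR.
    have a2 : rho `^ p <= rho ^+ k by rewrite -powR_mulrn ?(ltW rho0)//; exact: ler_powR.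
    by rewrite !ger0_norm ?subr_ge0 ?(le_trans a1 a2)// lerD2r.
  have r01 : 0 < rho <= 1 by rewrite rho0 ltW.
  have a1 : rho `^ p <= 1 by rewrite -(powRr0 rho); exact: ger_powR.
  have a2 : rho ^+ k <= rho `^ p by rewrite -powR_mulrn ?(ltW rho0)//; exact: ger_powR.
  by rewrite !ler0_norm ?subr_le0 ?(le_trans a2 a1)// lerN2 lerD2r.
rewrite subrX1 normrM mulrC ler_wpM2r// (le_trans (ler_norm_sum _ _ _))//.
rewrite (@le_trans _ _ (\sum_(i < k) M ^+ k))//; last first.
  by rewrite sumr_const card_ord mulr_natl.
apply: ler_sum => i _; rewrite normrX ger0_norm ?(ltW rho0)//.
apply: (@le_trans _ _ (M ^+ i)).
  by rewrite lerXn2r ?nnegrE ?(ltW rho0)// (le_trans ler01).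
by rewrite ler_weXn2l// ltnW.
Qed.

Section nonvanishing.
Variables (R : realType) (n : nat).
Local Notation V := 'rV[R]_n.
Implicit Types (phi u v : V -> R[i]) (x w xi : V).

Lemma fourier0 phi : fourier phi 0 = cintegral phi.
Proof.
rewrite /fourier; congr cintegral; apply/funext => x.
by rewrite -(scale0r x) dotpZr mul0r mulr0 oppr0 expi0 mul1r.
Qed.

Lemma cintegral_conj u C : dominated u C ->
  cintegral (fun x => conjc (u x)) = conjc (cintegral u).
Proof.
move=> du; have ii := dominated_iIm du.
apply/eqP; rewrite eq_complex /=; apply/andP; split; apply/eqP.
  by congr Rintegral; apply/funext => x; case: (u x).
rewrite -mulN1r -RintegralZl//; congr Rintegral; apply/funext => x.
by case: (u x) => ? ? /=; rewrite mulN1r.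
Qed.

Definition inverse_fourier phi x :=
  cintegral (fun xi => expi (2 * pi * dotp x xi) * fourier phi xi).

Lemma dominated_inverse phi C x : dominated (fourier phi) C ->
  dominated (fun xi => expi (2 * pi * dotp x xi) * fourier phi xi) C.
Proof.
move=> dF; apply: dominated_expi => //.
by have := measurable_pdotp x; under eq_fun do rewrite dotpC.
Qed.

(** Let F be the transform of phi and G the inverse Fourier integral of F. If
    G vanished identically, then by Fubini 0 = int conj(phi) G = int |F|^2;
    but F is continuous and F 0 = int phi is not 0. *)
Lemma inverse_fourier_neq0 phi : schwartz phi -> cintegral phi <> 0 ->
  exists x0, inverse_fourier phi x0 <> 0.
Proof.
move=> sphi phi0; apply: contrapT => /forallNP G0.
have {}G0 x : inverse_fourier phi x = 0 by have := G0 x; apply: contrapT.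
have rphi := schwartz_rapid0 sphi; have rF := fourier_rapid sphi.
have [D dphi] := rapid_dominated rphi; have [E dF] := rapid_dominated rF.
have [B FB] := rapid_bounded rF.
pose K (x xi : V) := conjc (phi x) * (expi (2 * pi * dotp x xi) * fourier phi xi).
have K1 x : cintegral (K x) = 0.
  rewrite (cintegralZ _ (dominated_inverse x dF)).
  by rewrite -[X in _ * X]/(inverse_fourier phi x) G0 mulr0.
have K2 xi : cintegral (K ^~ xi) = ((normc (fourier phi xi)) ^+ 2)%:C.
  have cE : conjc (fourier phi xi) =
      cintegral (fun x => conjc (expi (- (2 * pi * dotp x xi)) * phi x)).
    by rewrite (cintegral_conj (dominated_fourier xi dphi)).
  rewrite -mulcC_conj cE.
  have dc : dominated (fun x => conjc (expi (- (2 * pi * dotp x xi)) * phi x)) D.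
    have [m1 m2] := dominated_fourier xi dphi; split; first exact: cmeasurable_conj.
    by move=> x; rewrite normc_conj.
  rewrite -(cintegralZ _ dc); congr cintegral; apply/funext => x.
  by rewrite /K rmorphM/= [X in _ = _ * (X * _)]conj_expi opprK; ring.
have E1 : (fun x => cintegral (K x)) = (fun=> 0) by exact: funext K1.
have E2 : (fun xi => cintegral (K ^~ xi)) = (fun xi => (normc (fourier phi xi) ^+ 2)%:C).
  exact: funext K2.
have swp : cintegral (fun x => cintegral (K x)) = cintegral (fun xi => cintegral (K ^~ xi)).
  apply: (@cintegral_swap _ _ K (D * E)).
    apply: cmeasurableM.
      exact: (cmeasurable_comp (cmeasurable_conj rphi.1) measurable_fst).
    apply: cmeasurableM; last exact: (cmeasurable_comp rF.1 measurable_snd).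
    by apply: cmeasurable_expi; apply: measurable_funM => //; exact: measurable_dotp.
  move=> x xi; rewrite /K Normc.normcM normc_conj [X in _ * X]Normc.normcM normc_expi mul1r.
  rewrite (_ : D * E * _ * _ = (D * wt x ^- n.*2) * (E * wt xi ^- n.*2)); last by ring.
  by rewrite ler_pM ?normc_ge0//; [exact: dphi.2|exact: dF.2].
have {}swp := etrans (esym (congr1 (@cintegral R n) E1))
  (etrans swp (congr1 (@cintegral R n) E2)).
have I0 : \int[lebesgue_rV R n]_xi (normc (fourier phi xi) ^+ 2) = 0.
  have := congr1 (@complex.Re R) swp; rewrite /cintegral /= => <-.
  by rewrite Rintegral_cst// mul0r.
have [L [L0 FL]] := fourier_lipschitz rphi.
set c := normc (cintegral phi).
have c0 : 0 < c.
  by rewrite lt_neqAle normc_ge0 andbT eq_sym; apply/eqP => /Normc.eq0_normc.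
(* |F| >= c / 2 on the cube of side r at the origin. *)
pose r := c / (2 * (L + 1)).
have L10 : 0 < L + 1 by rewrite ltr_wpDl.
have r0 : 0 < r by rewrite divr_gt0// mulr_gt0.
have Fc xi : cube 0 r xi -> (c / 2) ^+ 2 <= normc (fourier phi xi) ^+ 2.
  move=> xir; rewrite lerXn2r ?nnegrE ?normc_ge0 ?divr_ge0 ?(ltW c0)//.
  have xr : `|xi| <= r.
    apply: norm_rV_le => [|i]; first exact: ltW.
    by have := xir i; rewrite mxE add0r => /andP[x0 xr]; rewrite ger0_norm.
  have := FL 0 xi; rewrite fourier0 sub0r normrN => FLx.
  have : c <= normc (fourier phi xi) + normc (cintegral phi - fourier phi xi).
    by rewrite (le_trans _ (normcD _ _))// addrC subrK.
  have : L * `|xi| <= c / 2.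
    rewrite (@le_trans _ _ ((L + 1) * r))//.
      by rewrite ler_pM// lerDl.
    by rewrite (_ : (L + 1) * r = c / 2)// /r; field; rewrite gt_eqF.
  lra.
have mF2 : measurable_fun setT (fun xi => normc (fourier phi xi) ^+ 2).
  have [m _] : cmeasurable (fun xi => fourier phi xi * conjc (fourier phi xi)).
    by apply: cmeasurableM; [exact: rF.1|exact: cmeasurable_conj rF.1].
  by move: m; under eq_fun do rewrite mulcC_conj.
have IF : (lebesgue_rV R n).-integrable setT (fun xi => (normc (fourier phi xi) ^+ 2)%:E).
  apply: (@dom_integrable _ _ _ (B * E)) => // xi.
  rewrite ger0_norm ?sqr_ge0// expr2 -mulrA ler_pM ?normc_ge0//; exact: dF.2.
have : ((\int[lebesgue_rV R n]_xi (normc (fourier phi xi) ^+ 2))%:E = 0)%E by rewrite I0.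
rewrite fineK ?integrable_fin_num// => I0'.
have : ((((c / 2) ^+ 2) * r ^+ n)%:E <=
    \int[lebesgue_rV R n]_xi (normc (fourier phi xi) ^+ 2)%:E)%E.
  apply: (@le_trans _ _
    (\int[lebesgue_rV R n]_(xi in cube 0 r) (normc (fourier phi xi) ^+ 2)%:E)%E).
    rewrite EFinM -(lebesgue_cube (0 : V) r0) -(integral_cst _ (measurable_cube _ _)).
    by apply: le_integral_ge0 => xi xr; rewrite lee_fin ?sqr_ge0//; exact: Fc.
  apply: ge0_subset_integral => //; first exact: measurable_cube.
  - exact/measurable_EFinP.
  - by move=> xi _; rewrite lee_fin sqr_ge0.
rewrite I0' lee_fin leNgt => /negP; apply.
by rewrite mulr_gt0// exprn_gt0// divr_gt0.
Qed.

End nonvanishing.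

(** * Ratios of the symbol *)

Section symbol_ratio.
Variables (R : realType) (n : nat) (m : R).
Hypothesis m0 : 0 < m.
Local Notation V := 'rV[R]_n.
Implicit Types (phi u v : V -> R[i]) (x w xi : V).

Definition frequency (j : 'I_n) (N : nat) : V := N%:R *: basis_rV R j.

Lemma dotp_frequency j N : dotp (frequency j N) (frequency j N) = N%:R ^+ 2.
Proof.
rewrite /frequency dotpZl dotpZr dotp_basis !mxE !eqxx mulr1 -expr2//.
Qed.

Lemma norm_frequency j N : `|frequency j N| <= N%:R.
Proof. by rewrite normrZ ger0_norm// ler_piMr// norm_basis. Qed.

Lemma bessel_frequency_ge j (N : nat) : N%:R `^ m <= bessel m (frequency j N).
Proof.
rewrite /bessel dotp_frequency (_ : N%:R `^ m = (N%:R ^+ 2) `^ (m / 2)).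
  by apply: ge0_ler_powR; rewrite ?nnegrE ?addr_ge0 ?sqr_ge0 ?divr_ge0 ?(ltW m0)// lerDr.
by rewrite -powR_mulrn// -powRrM mulrC divfK.
Qed.

Definition ratio_bound : R := (bdeg m)%:R * n.+1%:R ^+ (bdeg m) * n%:R.

(** |w + xi|^2 - |w|^2 is O(|w|), polynomially in xi, and is divided by 1 +
    |w|^2; the power m / 2 is handled by powR_sub1_le. *)
Lemma bessel_ratio j (N : nat) xi : (0 < N)%N ->
  `|bessel m (frequency j N + xi) / bessel m (frequency j N) - 1| <=
  ratio_bound * wt xi ^+ (bdeg m).+1.*2 / N%:R.
Proof.
move=> N0; set w := frequency j N.
have N1 : 1 <= N%:R :> R by rewrite ler1n.
have NN0 : 0 < N%:R :> R by rewrite ltr0n.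
set b := 1 + dotp w w; have b0 : 0 < b by exact: oneDdotp_gt0.
set a := 1 + dotp (w + xi) (w + xi); have a0 : 0 < a by exact: oneDdotp_gt0.
have r0 : 0 < a / b by rewrite divr_gt0.
have -> : bessel m (w + xi) / bessel m w = (a / b) `^ (m / 2).
  have aE : a `^ (m / 2) = (a / b) `^ (m / 2) * b `^ (m / 2).
    by rewrite -powRM ?(ltW r0) ?(ltW b0)// divfK// lt0r_neq0.
  by rewrite /bessel -/a -/b aE mulfK// lt0r_neq0// powR_gt0.
have bE : b = 1 + N%:R ^+ 2 by rewrite /b dotp_frequency.
have x0 := normr_ge0 xi.
have rB : `|a / b - 1| <= n%:R * wt xi ^+ 2 / N%:R.
  have -> : a / b - 1 = (2 * dotp w xi + dotp xi xi) / b.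
    rewrite -[X in _ - X](divff (lt0r_neq0 b0)) -mulrBl; congr (_ / _).
    by rewrite /a /b !dotpDl !dotpDr (dotpC xi w); ring.
  rewrite normrM normfV (gtr0_norm b0) ler_pdivrMr// mulrAC ler_pdivlMr//.
  have d1 : `|dotp w xi| <= n%:R * N%:R * `|xi|.
    by rewrite (le_trans (le_dotp _ _))// ler_wpM2r// ler_wpM2l// norm_frequency.
  have d2 := le_dotp xi xi.
  have tri : `|2 * dotp w xi + dotp xi xi| <= n%:R * (2 * N%:R * `|xi| + `|xi| * `|xi|).
    rewrite (le_trans (ler_normD _ _))// normrM ger0_norm//.
    move: d1 d2; lra.
  apply: (@le_trans _ _ (n%:R * (2 * N%:R * `|xi| + `|xi| * `|xi|) * N%:R)).
    by rewrite ler_wpM2r// ltW.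
  rewrite -!mulrA ler_wpM2l// bE /wt.
  have h1 : `|xi| * `|xi| * N%:R <= `|xi| * `|xi| * N%:R ^+ 2.
    by rewrite ler_wpM2l ?mulr_ge0// expr2 ler_peMl.
  have : 0 <= (1 + `|xi|) ^+ 2 by rewrite sqr_ge0.
  have : 0 <= N%:R ^+ 2 :> R by rewrite sqr_ge0.
  rewrite -subr_ge0 in h1; move=> s1 s2; rewrite -subr_ge0.
  rewrite (_ : _ - _ = (`|xi| * `|xi| * N%:R ^+ 2 - `|xi| * `|xi| * N%:R) +
    N%:R ^+ 2 + (1 + `|xi|) ^+ 2); last by ring.
  by apply: addr_ge0 => //; apply: addr_ge0.
have w1 : 1 <= wt xi ^+ 2 by rewrite exprn_ege1// wt_ge1.
have rM : a / b <= n.+1%:R * wt xi ^+ 2.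
  have : a / b - 1 <= n%:R * wt xi ^+ 2.
    rewrite (le_trans (ler_norm _))// (le_trans rB)// ler_pdivrMr// ler_peMr//.
    by rewrite mulr_ge0// exprn_ge0// wt_ge0.
  by rewrite -natr1 mulrDl mul1r; lra.
have M1 : 1 <= n.+1%:R * wt xi ^+ 2 by rewrite mulr_ege1// ler1n.
have p0 : 0 <= m / 2 by rewrite divr_ge0// ltW.
apply: (le_trans (powR_sub1_le p0 (bdeg_ge m0) r0 rM M1)).
rewrite (@le_trans _ _ ((bdeg m)%:R * (n.+1%:R * wt xi ^+ 2) ^+ bdeg m *
  (n%:R * wt xi ^+ 2 / N%:R)))//.
  by rewrite ler_wpM2l// mulr_ge0// exprn_ge0// mulr_ge0// exprn_ge0// wt_ge0.
rewrite (_ : wt xi ^+ (bdeg m).+1.*2 = (wt xi ^+ 2) ^+ bdeg m * wt xi ^+ 2); last first.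
  by rewrite -mul2n exprM exprSr.
rewrite exprMn /ratio_bound.
by rewrite le_eqVlt; apply/orP; left; apply/eqP; ring.
Qed.

End symbol_ratio.

(** * Lower bound on a fixed cube *)

Section lower_bound.
Variables (R : realType) (n : nat) (m : R).
Hypothesis m0 : 0 < m.
Local Notation V := 'rV[R]_n.
Implicit Types (phi u v : V -> R[i]) (x w xi : V).

Lemma expi_dotpB x y xi :
  normc (expi (2 * pi * dotp x xi) - expi (2 * pi * dotp y xi)) <=
  4 * pi * n%:R * `|x - y| * wt xi.
Proof.
have p0 := pi_ge0 R.
have -> : expi (2 * pi * dotp x xi) - expi (2 * pi * dotp y xi) =
    expi (2 * pi * dotp y xi) * (expi (2 * pi * dotp (x - y) xi) - 1).
  by rewrite mulrBr mulr1 -expiD dotpDl dotpNl; congr (expi _ - _); ring.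
rewrite Normc.normcM normc_expi mul1r (le_trans (normc_expiB1 _))//.
rewrite !normrM (ger0_norm p0) (ger0_norm (ler0n R 2)).
rewrite (@le_trans _ _ (2 * (2 * pi * (n%:R * `|x - y| * `|xi|))))//.
  by rewrite ler_wpM2l// ler_wpM2l ?mulr_ge0// le_dotp.
rewrite (_ : 2 * _ = 4 * pi * n%:R * `|x - y| * `|xi|); last by ring.
by rewrite ler_wpM2l ?mulr_ge0// /wt lerDr.
Qed.

(** The three errors are the ratio of the symbols, the dilation of F and the
    displacement of x. *)
Lemma kernel_error (r e e0 Ft F0 : R[i]) (A a1 a2 a3 : R) :
  normc e = 1 -> normc Ft <= A -> normc (r - 1) <= a1 -> normc (Ft - F0) <= a2 ->
  normc (e - e0) <= a3 ->
  normc (r * e * Ft - F0 * e0) <= a1 * A + a2 + a3 * normc F0.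
Proof.
move=> e1 FtA ra Fa ea.
have -> : r * e * Ft - F0 * e0 = (r - 1) * e * Ft + e * (Ft - F0) + (e - e0) * F0 by ring.
rewrite (le_trans (normcD _ _))// lerD//.
  rewrite (le_trans (normcD _ _))// lerD// !Normc.normcM e1 ?mulr1 ?mul1r//.
  by rewrite ler_pM ?normc_ge0.
by rewrite Normc.normcM ler_wpM2r// normc_ge0.
Qed.

(** With t = tau / N and w = N e_j, the integral of convolution_bessel divided
    by the unimodular factor e^(2 pi i x.w) and by <w>^m is close to F 0 times
    the inverse Fourier integral of F at x. The latter is nonzero at some x0,
    and the error is small for N large, tau small and x close to x0. *)
Lemma convolution_bessel_ge phi (j : 'I_n) : schwartz phi -> cintegral phi <> 0 ->
  exists c r : R, exists x0 : V, exists N0 : nat, [/\ 0 < c, 0 < r &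
    forall N : nat, (N0 <= N)%N -> forall x, `|x - x0| <= r ->
    exists2 t, 0 < t <= 1 & c * N%:R `^ m <=
      normc (convolution (dilate phi t) (Jop n m (modulated phi (frequency R j N))) x)].
Proof.
move=> sphi phi0; have rphi := schwartz_rapid0 sphi; have rF := fourier_rapid sphi.
have [x0 G0] := inverse_fourier_neq0 sphi phi0.
have [D dphi] := rapid_dominated rphi; have [D' dF] := rapid_dominated rF.
have [A FA] := rapid_bounded rF.
have [L [L0 FL]] := fourier_lipschitz rphi.
pose K := (bdeg m).+1.*2.
have [E [E0 FE]] := rapid_wt K.+1 rF.
set F := fourier phi in rF dF FA FL FE.
have F00 : F 0 = cintegral phi by exact: fourier0.
pose B := ratio_bound n m.
have B0 : 0 <= B by rewrite /B /ratio_bound !mulr_ge0// exprn_ge0.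
have A0 : 0 <= A := le_trans (normc_ge0 _) (FA 0).
have W0 := wtmass_ge0 R n.
have p0 := pi_ge0 R.
set g := normc (F 0 * inverse_fourier phi x0).
have g0 : 0 < g.
  rewrite /g lt_neqAle normc_ge0 andbT eq_sym Normc.normcM mulf_eq0 negb_or F00.
  by apply/andP; split; apply/eqP => /Normc.eq0_normc.
pose S := 2 * E * wtmass R n.
have S0 : 0 <= S by rewrite /S !mulr_ge0.
(* tau, r and N0 are such that each of the three errors is at most g / 6. *)
pose tau := g / (6 * (S * L) + g).
have tau0 : 0 < tau by rewrite divr_gt0// ltr_wpDl// !mulr_ge0.
have tau1 : tau <= 1.
  by rewrite ler_pdivrMr ?mul1r ?lerDr ?mulr_ge0// ltr_wpDl// !mulr_ge0.
have tauS : S * (L * tau) <= g / 6.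
  rewrite /tau (_ : S * _ = S * L * g / (6 * (S * L) + g)); last by rewrite !mulrA.
  rewrite ler_pdivrMr; last by rewrite ltr_wpDl// !mulr_ge0.
  rewrite (_ : g / 6 * _ = S * L * g + g * g / 6); last by field.
  by rewrite lerDl divr_ge0// mulr_ge0// ltW.
pose Q := 4 * pi * n%:R * normc (F 0).
have Q0 : 0 <= Q by rewrite /Q !mulr_ge0// normc_ge0.
pose r := g / (6 * (S * Q) + 6).
have SQ0 : 0 <= 6 * (S * Q) by rewrite mulr_ge0// mulr_ge0.
have r0 : 0 < r by rewrite divr_gt0// ltr_wpDl.
have rS : S * (Q * r) <= g / 6.
  rewrite /r (_ : S * _ = S * Q * g / (6 * (S * Q) + 6)); last by rewrite !mulrA.
  rewrite ler_pdivrMr; last by rewrite ltr_wpDl.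
  rewrite (_ : g / 6 * _ = S * Q * g + g); last by field.
  by rewrite lerDl ltW.
pose N0 := (Num.truncn (6 * (S * (B * A)) / g)).+1.
exists (g / 2), r, x0, N0; split => //; first by rewrite divr_gt0.
move=> N N0N x xr.
have NN : 0 < N%:R :> R by rewrite ltr0n (leq_trans _ N0N).
have Npos : (0 < N)%N by rewrite (leq_trans _ N0N).
have NS : S * (B / N%:R * A) <= g / 6.
  have : 6 * (S * (B * A)) / g <= N%:R.
    by rewrite (le_trans (ltW (truncnS_gt _)))// ler_nat.
  rewrite ler_pdivrMr// => H.
  rewrite (_ : S * _ = S * (B * A) / N%:R); last by ring.
  rewrite ler_pdivrMr//; move: H; set Z := S * (B * A); lra.
set w := frequency R j N.
pose t := tau / N%:R.
have t0 : 0 < t by rewrite divr_gt0.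
have N1 : 1 <= N%:R :> R by rewrite ler1n.
have t1 : t <= 1 by rewrite /t ler_pdivrMr// mul1r (le_trans tau1).
exists t; first by rewrite t0.
rewrite convolution_bessel//.
pose H xi := (bessel m (w + xi) / bessel m w)%:C * expi (2 * pi * dotp x xi) *
  F (t *: (w + xi)) * F xi.
have bw0 : 0 < bessel m w by exact: bessel_gt0.
have HE xi : bessel_kernel m phi t x (w + xi) * fourier phi xi =
    ((bessel m w)%:C * expi (2 * pi * dotp x w)) * H xi.
  rewrite /bessel_kernel -/F /H dotpDr mulrDr expiD.
  rewrite (_ : (bessel m (w + xi))%:C =
    (bessel m w)%:C * (bessel m (w + xi) / bessel m w)%:C); last first.
    by rewrite -rmorphM/= mulrC divfK// lt0r_neq0.
  by ring.
pose H0 xi := F 0 * (expi (2 * pi * dotp x0 xi) * F xi).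
have dG := dominated_inverse x0 dF.
have dH0 : dominated H0 (normc (F 0) * D') by exact: dominatedZ.
pose eps := B / N%:R * A + L * tau + Q * r.
have eps0 : 0 <= eps.
  apply: addr_ge0; last exact: mulr_ge0 Q0 (ltW r0).
  by apply: addr_ge0; [rewrite mulr_ge0// divr_ge0|exact: mulr_ge0 L0 (ltW tau0)].
have err xi : normc (H xi - H0 xi) <= E * eps * wt xi ^- n.*2.
  have -> : H xi - H0 xi = ((bessel m (w + xi) / bessel m w)%:C * expi (2 * pi * dotp x xi) *
     F (t *: (w + xi)) - F 0 * expi (2 * pi * dotp x0 xi)) * F xi by rewrite /H /H0; ring.
  have wK : 1 <= wt xi ^+ K by rewrite exprn_ege1// wt_ge1.
  have w1 := wt_ge1 xi.
  have k1 : normc ((bessel m (w + xi) / bessel m w)%:C - 1) <= B / N%:R * wt xi ^+ K.+1.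
    rewrite (_ : (bessel m (w + xi) / bessel m w)%:C - 1 =
      (bessel m (w + xi) / bessel m w - 1)%:C); last by rewrite rmorphB rmorph1.
    rewrite normc_real.
    rewrite (le_trans (bessel_ratio m0 j xi Npos))// -/B mulrAC ler_wpM2l ?divr_ge0//.
    by rewrite exprSr ler_peMr// exprn_ge0// wt_ge0.
  have k2 : normc (F (t *: (w + xi)) - F 0) <= L * tau * wt xi ^+ K.+1.
    rewrite (le_trans (FL _ _))// subr0 -mulrA ler_wpM2l// (@le_trans _ _ (tau * wt xi))//; last first.
      by rewrite ler_wpM2l ?(ltW tau0)// exprS ler_peMr// wt_ge0.
    rewrite normrZ gtr0_norm// /t mulrAC ler_pdivrMr// -[leRHS]mulrA ler_wpM2l ?(ltW tau0)//.
    rewrite (le_trans (ler_normD _ _))//.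
    rewrite (@le_trans _ _ (N%:R + `|xi|))// ?lerD2r ?norm_frequency//.
    by rewrite /wt mulrDl mul1r lerD2l ler_peMr.
  have k3 : normc (expi (2 * pi * dotp x xi) - expi (2 * pi * dotp x0 xi)) <=
      4 * pi * n%:R * r * wt xi ^+ K.+1.
    rewrite (le_trans (expi_dotpB _ _ _))// ler_pM ?mulr_ge0 ?wt_ge0//.
      by rewrite ler_wpM2l// !mulr_ge0.
    by rewrite exprS ler_peMr// wt_ge0.
  have := kernel_error (normc_expi _) (FA _) k1 k2 k3 => ke.
  rewrite Normc.normcM (@le_trans _ _ (eps * (normc (F xi) * wt xi ^+ K.+1)))//.
    rewrite (_ : eps * _ = (eps * wt xi ^+ K.+1) * normc (F xi)); last by ring.
    rewrite ler_wpM2r ?normc_ge0// (le_trans ke)// /eps /Q.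
    by rewrite le_eqVlt; apply/orP; left; apply/eqP; ring.
  rewrite (_ : E * eps * _ = eps * (E * wt xi ^- n.*2)); last by ring.
  by rewrite ler_wpM2l.
have [DK dK] := dominated_bessel_kernel m0 sphi x (lt0r_neq0 t0).
have [C dH] : exists C, dominated H C.
  have mF : cmeasurable F by exact: rF.1.
  have dS := dominated_shift w dK.
  have := dominatedZ (((bessel m w)%:C * expi (2 * pi * dotp x w)))^-1 (dominatedM dS mF FA).
  have bC : (bessel m w)%:C * expi (2 * pi * dotp x w) != 0 :> R[i].
    apply/eqP => /(congr1 (@Normc.normc R)).
    rewrite Normc.normcM normc_expi mulr1 normc_real Normc.normc0.
    by move/eqP; rewrite normr_eq0 gt_eqF.
  under [X in dominated X]eq_fun do rewrite mulrC [X in X / _]mulrC HE mulrAC mulfV// mul1r.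
  by move=> dH; eexists; exact: dH.
have dd : dominated (fun xi => H xi - H0 xi) (E * eps).
  by split => //; apply: cmeasurableB; [exact: dH.1|exact: dH0.1].
rewrite (funext HE) (cintegralZ _ dH) Normc.normcM Normc.normcM normc_expi mulr1.
rewrite normc_real gtr0_norm//.
have Hg : g / 2 <= normc (cintegral H).
  have := normc_cintegral dd; rewrite (cintegralB dH dH0) (cintegralZ _ dG).
  rewrite -[X in _ - _ * X]/(inverse_fourier phi x0) => e1.
  have e2 : 2 * (E * eps) * wtmass R n <= g / 2.
    rewrite (_ : 2 * _ * _ = S * (B / N%:R * A) + S * (L * tau) + S * (Q * r)).
      by move: NS tauS rS; lra.
    by rewrite /S /eps; ring.
  have : g <= normc (cintegral H) + normc (cintegral H - F 0 * inverse_fourier phi x0).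
    by have := le_normcB (cintegral H) (cintegral H - F 0 * inverse_fourier phi x0); rewrite subKr.
  move: e1 e2; lra.
rewrite mulrC ler_pM ?powR_ge0 ?divr_ge0 ?(ltW g0)//.
exact: bessel_frequency_ge.
Qed.

End lower_bound.

(** * The symbol class *)

Section symbols.
Variables (R : realType) (n : nat).
Local Notation V := 'rV[R]_n.
Local Notation W := (V * V)%type.
Implicit Types (f g : W -> R) (p v : W) (r s : R).

(** The functions of xi obtained from constants, coordinates and real powers
    of 1 + |xi|^2 by sums and products, graded by their order of growth. The
    zero function has every order, so that the derivatives in x, which vanish,
    fit the grading. *)
Inductive symbol_like : R -> (W -> R) -> Prop :=
| sym_zero r : symbol_like r (cst 0)
| sym_cst c : symbol_like 0 (cst c)
| sym_coord i : symbol_like 1 (fun p => p.2 ord0 i)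
| sym_pow a : symbol_like (2 * a) (fun p => (1 + dotp p.2 p.2) `^ a)
| sym_add r f g : symbol_like r f -> symbol_like r g -> symbol_like r (f + g)
| sym_mul r s f g : symbol_like r f -> symbol_like s g -> symbol_like (r + s) (f * g).

Lemma is_derive_coord i p v : is_derive p v (fun p : W => p.2 ord0 i) (v.2 ord0 i).
Proof.
have E : (fun h : R => h^-1 *: (((fun p : W => p.2 ord0 i) \o shift p) (h *: v) -
    p.2 ord0 i)) @ 0^' --> v.2 ord0 i.
  apply: (@cvg_near_cst _ _ (v.2 ord0 i)).
  near=> h; apply/eqP; rewrite /= !mxE addrK /GRing.scale/= mulKf//.
  by near: h; exact: nbhs_dnbhs_neq.
by apply: DeriveDef; [apply/cvg_ex; exists (v.2 ord0 i)|exact: cvg_lim E].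
Unshelve. all: by end_near. Qed.

Lemma differentiable_coord2 i p : differentiable (fun p : W => p.2 ord0 i) p.
Proof.
have @f : {linear W -> R}.
  by exists (fun p : W => p.2 ord0 i); do 2![eexists]; do ?[constructor];
     rewrite ?mxE// => ? *; rewrite ?mxE//; move=> ?; rewrite !mxE.
rewrite (_ : (fun _ => _) = f)//; apply: linear_differentiable => x.
have h : continuous (fun y : V => y ord0 i) by exact: coord_continuous.
exact: (continuous_comp (@cvg_snd _ _ _ _ _) (h x.2)).
Qed.

Lemma differentiable_dotp2 p : differentiable (fun p : W => 1 + dotp p.2 p.2) p.
Proof.
rewrite (_ : (fun _ => _) = cst 1 +
  \sum_(i < n) (fun p : W => p.2 ord0 i) * (fun p : W => p.2 ord0 i)).
  apply: differentiableD; first exact: differentiable_cst.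
  by apply: differentiable_sum => i; apply: differentiableM; exact: differentiable_coord2.
apply/funext => z /=; rewrite fctE /=; congr (_ + _).
by rewrite /dotp fct_sumE.
Qed.

Lemma is_derive_dotp2 p v :
  is_derive p v (fun p : W => 1 + dotp p.2 p.2) (\sum_(i < n) 2 * v.2 ord0 i * p.2 ord0 i).
Proof.
rewrite (_ : (fun _ => _) = cst 1 +
  \sum_(i < n) (fun p : W => p.2 ord0 i) * (fun p : W => p.2 ord0 i)).
  rewrite -[X in is_derive _ _ _ X]add0r; apply: is_deriveD.
  apply: is_derive_sum => i.
  rewrite (_ : 2 * _ * _ = p.2 ord0 i *: v.2 ord0 i + p.2 ord0 i *: v.2 ord0 i).
    by apply: is_deriveM; exact: is_derive_coord.
  by rewrite /GRing.scale/=; ring.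
apply/funext => z /=; rewrite fctE /=; congr (_ + _).
by rewrite /dotp fct_sumE.
Qed.

Lemma differentiable_powR (a x : R) : 0 < x -> differentiable (fun y : R => y `^ a) x.
Proof. by move=> x0; apply/derivable1_diffP; have [] := is_derive1_powR a x0. Qed.

Lemma differentiable_powR_comp f a p : 0 < f p -> differentiable f p ->
  differentiable (fun z => f z `^ a) p.
Proof.
move=> f0 df; apply: (@differentiable_comp _ _ _ _ f (fun y => y `^ a)) => //.
exact: differentiable_powR.
Qed.

Lemma derive_powR_comp f a p v : 0 < f p -> differentiable f p ->
  'D_v (fun z => f z `^ a) p = a * f p `^ (a - 1) * 'D_v f p.
Proof.
move=> f0 df; have dg := differentiable_powR a f0.
rewrite (deriveE _ (differentiable_powR_comp a f0 df)) (deriveE _ df).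
rewrite (@diff_comp _ _ _ _ f (fun y => y `^ a) p df dg) /=.
rewrite -[X in 'd _ _ X = _]mulr1 -[X in 'd _ _ X = _]/(_ *: (1 : R)) linearZ /=.
rewrite -(deriveE _ dg) (@derive_val _ _ _ _ _ _ _ (is_derive1_powR a f0)).
by rewrite /GRing.scale/= mulrC.
Qed.

Lemma symbol_like_cast r s f : r = s -> symbol_like r f -> symbol_like s f.
Proof. by move=> ->. Qed.

Lemma symbol_like_differentiable r f p : symbol_like r f -> differentiable f p.
Proof.
elim => {r f} [r|c|i|a|r f g _ df _ dg|r s f g _ df _ dg].
- exact: differentiable_cst.
- exact: differentiable_cst.
- exact: differentiable_coord2.
- apply: differentiable_powR_comp; last exact: differentiable_dotp2.
  by rewrite ltr_wpDr// sumr_ge0// => i _; rewrite -expr2 sqr_ge0.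
- exact: differentiableD.
- exact: differentiableM.
Qed.

(** A derivative turns a coordinate into a constant, and (1 + |xi|^2)^a into a
    linear form times (1 + |xi|^2)^(a - 1); in both cases the order drops by
    1. *)
Lemma symbol_like_derive r f v : symbol_like r f -> symbol_like (r - 1) (fun p => 'D_v f p).
Proof.
elim => {r f} [r|c|i|a|r f g sf df sg dg|r s f g sf df sg dg].
- rewrite (_ : (fun _ => _) = cst 0); first exact: sym_zero.
  by apply/funext => p; rewrite derive_cst.
- rewrite (_ : (fun _ => _) = cst 0); first exact: sym_zero.
  by apply/funext => p; rewrite derive_cst.
- rewrite (_ : (fun _ => _) = cst (v.2 ord0 i)); first by rewrite subrr; exact: sym_cst.
  by apply/funext => p; rewrite (@derive_val _ _ _ _ _ _ _ (is_derive_coord i p v)).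
- rewrite (_ : (fun _ => _) = cst a * (fun p => (1 + dotp p.2 p.2) `^ (a - 1)) *
      (\sum_(i < n) cst (2 * v.2 ord0 i) * (fun p : W => p.2 ord0 i))).
    apply: (@symbol_like_cast (0 + 2 * (a - 1) + 1)); first by ring.
    apply: sym_mul; first by apply: sym_mul; [exact: sym_cst|exact: sym_pow].
    elim/big_ind : _ => [|f g|i _]; [exact: sym_zero|exact: sym_add|].
    by rewrite -[X in symbol_like X]add0r; apply: sym_mul; [exact: sym_cst|exact: sym_coord].
  apply/funext => p; rewrite derive_powR_comp; last 2 first.
  + by rewrite ltr_wpDr// sumr_ge0// => i _; rewrite -expr2 sqr_ge0.
  + exact: differentiable_dotp2.
  rewrite (@derive_val _ _ _ _ _ _ _ (is_derive_dotp2 p v)).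
  by rewrite /= !fctE fct_sumE.
- rewrite (_ : (fun _ => _) = (fun p => 'D_v f p) + (fun p => 'D_v g p)); first exact: sym_add.
  apply/funext => p; rewrite deriveD//; apply: diff_derivable;
    [exact: symbol_like_differentiable sf|exact: symbol_like_differentiable sg].
- rewrite (_ : (fun _ => _) = f * (fun p => 'D_v g p) + g * (fun p => 'D_v f p)).
    apply: sym_add.
      by apply: (@symbol_like_cast (r + (s - 1))); [ring|exact: sym_mul].
    by apply: (@symbol_like_cast (s + (r - 1))); [ring|exact: sym_mul].
  apply/funext => p; rewrite deriveM//; apply: diff_derivable;
    [exact: symbol_like_differentiable sf|exact: symbol_like_differentiable sg].
Qed.

Lemma japanese_ge1 (xi : V) : 1 <= japanese xi.
Proof.
rewrite /japanese -{1}sqrtr1 ler_sqrt ?lerDl.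
  by rewrite sumr_ge0// => i _; rewrite -expr2 sqr_ge0.
by rewrite addr_ge0// sumr_ge0// => i _; rewrite -expr2 sqr_ge0.
Qed.

Lemma symbol_like_bound r f : symbol_like r f ->
  exists C : R, forall p, `|f p| <= C * japanese p.2 `^ r.
Proof.
elim => {r f} [r|c|i|a|r f g _ [C Cf] _ [D Dg]|r s f g _ [C Cf] _ [D Dg]].
- by exists 0 => p; rewrite normr0 mul0r.
- by exists `|c| => p; rewrite powRr0 mulr1.
- exists 1 => p; rewrite mul1r powRr1 ?(le_trans ler01) ?japanese_ge1//.
  rewrite -sqrtr_sqr ler_wsqrtr// /dotp (bigD1 i)//= -expr2 addrCA lerDl addr_ge0//.
  by rewrite sumr_ge0// => j _; rewrite -expr2 sqr_ge0.
- exists 1 => p; rewrite mul1r ger0_norm ?powR_ge0// powRrM /japanese.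
  rewrite (powR_mulrn 2) ?sqrtr_ge0// sqr_sqrtr// addr_ge0// sumr_ge0// => i _.
  by rewrite -expr2 sqr_ge0.
- by exists (C + D) => p; rewrite mulrDl (le_trans (ler_normD _ _))// lerD.
- exists (C * D) => p; rewrite powRD; last first.
    by apply/implyP => _; rewrite gt_eqF// (lt_le_trans ltr01)// japanese_ge1.
  by rewrite mulrACA normrM ler_pM.
Qed.

Lemma cderive_real v f : cderive v (fun p => (f p)%:C) = (fun p => ('D_v f p)%:C).
Proof. by apply/funext => p; rewrite /cderive /= derive_cst. Qed.

Lemma symbol_like_iderive r f (l : seq W) : symbol_like r f ->
  exists2 g, symbol_like (r - (size l)%:R) g &
             iderive l (fun p => (f p)%:C) = (fun p => (g p)%:C).
Proof.
move=> sf; elim: l => [|v l [g sg gE]] /=; first by exists f; rewrite ?subr0.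
exists (fun p => 'D_v g p); last by rewrite gE cderive_real.
rewrite -natr1 opprD addrA; exact: symbol_like_derive.
Qed.

Lemma size_mdirs (T : Type) (e : 'I_n -> T) (alpha : multi_index n) :
  size (mdirs e alpha) = mabs alpha.
Proof.
rewrite /mdirs /mabs size_flatten /shape -map_comp sumnE big_map big_enum /=.
by apply: eq_bigr => i _; rewrite size_nseq.
Qed.

(** In symbol_like the derivatives in x lower the order too; the bound that
    results is the stronger one because <xi> >= 1. *)
Lemma bessel_symbol_class m : symbol_class m (@bessel_symbol R n m).
Proof.
have sm : symbol_like m (fun p : W => (1 + dotp p.2 p.2) `^ (m / 2)).
  by apply: (@symbol_like_cast (2 * (m / 2))); [field|exact: sym_pow].
split=> [l p|alpha beta].
  have [g sg gE] := symbol_like_iderive l sm.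
  rewrite /cdifferentiable gE /=; split; first exact: symbol_like_differentiable sg.
  exact: differentiable_cst.
have [g sg gE] := symbol_like_iderive (mdirs (fun i => (basis_rV R i, 0)) alpha ++
  mdirs (fun i => (0, basis_rV R i)) beta) sm.
have [C gC] := symbol_like_bound sg.
exists `|C| => x xi; rewrite /mderive2 gE [normc _]/= expr0n/= addr0 sqrtr_sqr.
rewrite (le_trans (gC _))// (le_trans (ler_wpM2r (powR_ge0 _ _) (ler_norm C)))//.
rewrite ler_wpM2l//; apply: ler_powR; first exact: japanese_ge1.
by rewrite size_cat !size_mdirs lerD2l lerN2 ler_nat leq_addl.
Qed.

End symbols.

(** * Unboundedness *)

(** The norms of the modulated bumps with frequency w = N e_j are bounded by
    modulated_hM_le, whereas on a fixed cube the maximal functions of their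
    images are at least c N^m by convolution_bessel_ge. *)
Lemma Jop_unbounded (R : realType) (n : nat) (q lam m : R)
    (phi : 'rV[R]_n -> R[i]) :
  (0 < n)%N -> 0 < q -> q < lam -> 0 < m ->
  schwartz phi -> cintegral phi <> 0 ->
  ~ bounded_on_hM phi q lam (Jop n m).
Proof.
move=> n0 q0 qlam m0 sphi phi0 [C HC]; pose j := Ordinal n0.
have [M HM] := modulated_hM_le sphi q0 qlam.
have [c [r [x0 [N0 [c0 r0 low]]]]] := convolution_bessel_ge m0 j sphi phi0.
pose K := (r ^+ n) `^ lam^-1 * c.
have K0 : 0 < K by rewrite mulr_gt0// powR_gt0// exprn_gt0.
have key (N : nat) : (N0 <= N)%N -> K * N%:R `^ m <= `|C| * `|M|.
  move=> N0N; pose w := frequency R j N.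
  have fin : (hM_norm phi q lam (modulated phi w) < +oo)%E.
    by rewrite (le_lt_trans (HM w))// ltry.
  have := HC (modulated phi w) (conj (modulated_tempered w sphi) fin).
  have A0 : 0 <= c * N%:R `^ m by rewrite mulr_ge0 ?powR_ge0// ltW.
  have lo : (((r ^+ n) `^ lam^-1 * (c * N%:R `^ m))%:E <=
      hM_norm phi q lam (Jop n m (modulated phi w)))%E.
    rewrite /hM_norm; set g := maximal _ _.
    apply: (@morrey_norm_ge _ _ q lam q0 g x0 r _ r0 A0) => y yx0.
    have yr : `|y - x0| <= r.
      apply: norm_rV_le => [|i]; first exact: ltW.
      by rewrite !mxE; have /andP[h1 h2] := yx0 i; rewrite ger0_norm; lra.
    have [t t01 Ht] := low N N0N y yr.
    apply: le_trans (lee_abs _); apply: le_ereal_sup_tmp.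
    exists (normc (convolution (dilate phi t) (Jop n m (modulated phi w)) y))%:E.
      by exists t.
    by rewrite lee_fin.
  move=> /(le_trans lo).
  have h0 : (0 <= hM_norm phi q lam (modulated phi w))%E.
    rewrite -[leLHS](_ : ((r ^+ n) `^ lam^-1 * 0)%:E = _); last by rewrite mulr0.
    rewrite /hM_norm; set g := maximal _ _.
    apply: (@morrey_norm_ge _ _ q lam q0 g x0 r _ r0 (lexx 0)) => y _.
    exact: abse_ge0.
  have hM_ : (hM_norm phi q lam (modulated phi w) <= `|M|%:E)%E.
    by rewrite (le_trans (HM w))// lee_fin ler_norm.
  move=> le1.
  have : (((r ^+ n) `^ lam^-1 * (c * N%:R `^ m))%:E <= `|C|%:E * `|M|%:E)%E.
    rewrite (le_trans le1)//; set h := hM_norm _ _ _ _.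
    rewrite (@le_trans _ _ (`|C|%:E * h)%E)//.
      by rewrite lee_wpmul2r// lee_fin ler_norm.
    by rewrite lee_wpmul2l// lee_fin.
  by rewrite -EFinM lee_fin mulrA.
(* N is chosen so that K * N ^ m exceeds |C| |M| by at least K. *)
pose X := `|C| * `|M| / K + 1.
have X1 : 1 <= X by rewrite /X lerDr; apply: divr_ge0; [exact: mulr_ge0|exact: ltW].
pose N := maxn N0 (Num.truncn (X `^ m^-1)).+1.
have := key N (leq_maxl _ _); rewrite leNgt => /negP; apply.
have XN : X `^ m^-1 <= N%:R.
  by rewrite (le_trans (ltW (truncnS_gt _)))// ler_nat leq_maxr.
have : X <= N%:R `^ m.
  have -> : X = (X `^ m^-1) `^ m.
    by rewrite -powRrM mulVf ?lt0r_neq0// powRr1// (le_trans ler01).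
  by apply: ge0_ler_powR; rewrite ?nnegrE ?powR_ge0 ?(ltW m0).
move=> XNm; rewrite (@lt_le_trans _ _ (K * X))//; last by rewrite ler_wpM2l// ltW.
by rewrite /X mulrDr mulr1 mulrCA divff ?gt_eqF// mulr1 ltrDl.
Qed.

Unset Implicit Arguments.

Theorem mainTheorem5 (R : realType) (n : nat) (q lam m : R)
    (phi : 'rV[R]_n -> R[i]) :
  (0 < n)%N -> 0 < q -> q < lam -> lam <= 1 -> 0 < m ->
  schwartz phi -> cintegral phi <> 0 ->
  [/\ ~ (forall T, OpS n m T -> bounded_on_hM phi q lam T),
      OpS n m (Jop n m)
    & ~ bounded_on_hM phi q lam (Jop n m)].
Proof.
move=> n0 q0 qlam lam1 m0 sphi phi0.
have Jm : OpS n m (Jop n m) by exists (@bessel_symbol R n m) => //; exact: bessel_symbol_class.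
have unb := Jop_unbounded (n := n) n0 q0 qlam m0 sphi phi0.
by split => // bnd; apply: unb; exact: bnd.
Qed.
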